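(* The complete bipartite graph $K_{3,3}$ satisfies $$p^*\left(\mathrm{Forb}(K_{3,3})\right)=\sqrt{2}-1\qquad\text{and}\qquad d^*\left(\mathrm{Forb}(K_{3,3})\right)=3-2\sqrt{2}.$$ Moreover, $p^*\left(\mathrm{Forb}(K_{3,3})\right)$ is the point of local maximum of $g_{K'}(p)$, where $K'$ is the colored regularity graph consisting of one white vertex, two black vertices and all edges gray.
   Context: All graphs are finite and simple. $\mathrm{Forb}(H)$ is the class of graphs with no induced copy of $H$. For a class of graphs $\mathcal{P}$ and a graph $G$, $\mathrm{Dist}(G,\mathcal{P})=\min\{|E(F)\triangle E(G)| : F\in\mathcal{P},\,V(F)=V(G)\}$ and $\mathrm{Dist}(n,\mathcal{P})=\max\{\mathrm{Dist}(G,\mathcal{P}):|V(G)|=n\}$. For a hereditary property $\mathcal{H}$ (a class of graphs closed under deletion of vertices), $d^*(\mathcal{H})=\lim_{n\to\infty}\mathrm{Dist}(n,\mathcal{H})/\binom{n}{2}$ (this limit exists), and $p^*(\mathcal{H})\in[0,1]$ is a value such that, with high probability, $\mathrm{Dist}(n,\mathcal{H})=\mathrm{Dist}(G(n,p^*(\mathcal{H})),\mathcal{H})+o(n^2)$, where $G(n,p)$ is the Erdős–Rényi random graph. A colored regularity graph (CRG) $K$ is a finite complete graph whose vertices are each colored white or black and whose edges are each colored white, gray or black. For a CRG $K$ on $k$ vertices and $p\in[0,1]$, let $\mathbf{M}_K(p)$ be the symmetric $k\times k$ matrix indexed by $V(K)$ whose diagonal entry at $v$ is $p$ if $v$ is white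 and $1-p$ if $v$ is black, and whose off-diagonal entry at $(u,v)$ is $p$, $1-p$ or $0$ according to whether the edge $\{u,v\}$ is white, black or gray. Then $$g_K(p)=\min\{\mathbf{u}^T\mathbf{M}_K(p)\mathbf{u} : \mathbf{u}\in\mathbb{R}^k,\ \mathbf{u}^T\mathbf{1}=1,\ \mathbf{u}\ge\mathbf{0}\}.$$ *)

(* Defs.v *)
From HB Require Import structures.
From mathcomp Require Import all_boot all_order all_algebra.
From mathcomp Require Import all_classical all_reals all_analysis.

Set Implicit Arguments.
Unset Strict Implicit.
Unset Printing Implicit Defensive.

Import Order.TTheory GRing.Theory Num.Theory.
Import numFieldNormedType.Exports.

Local Open Scope classical_set_scope.
Local Open Scope ring_scope.

(* A simple graph on the vertex type T is its edge set; an edge is an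
   unordered pair of distinct vertices, i.e. a subset of T of cardinality 2. *)
Record sgraph (T : finType) := SGraph {
  edges :> {set {set T}};
  _ : [forall e in edges, #|e| == 2]
}.

HB.instance Definition _ (T : finType) := [isSub for @edges T].
HB.instance Definition _ (T : finType) := [Equality of sgraph T by <:].
HB.instance Definition _ (T : finType) := [Choice of sgraph T by <:].
HB.instance Definition _ (T : finType) := [Countable of sgraph T by <:].
HB.instance Definition _ (T : finType) := [Finite of sgraph T by <:].

Definition adj (T : finType) (G : sgraph T) (x y : T) : bool :=
  [set x; y]%SET \in edges G.

Definition graph_class := forall T : finType, pred (sgraph T).

Definition has_induced (S T : finType) (H : sgraph S) (G : sgraph T) : bool :=
  [exists f : {ffun S -> T},
    injectiveb f && [forall x, forall y, adj G (f x) (f y) == adj H x y]].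

Definition Forb (S : finType) (H : sgraph S) : graph_class :=
  fun T G => ~~ has_induced H G.

Definition edit (T : finType) (F G : sgraph T) : nat :=
  #|((edges F :\: edges G) :|: (edges G :\: edges F))%SET|.

(* The default value 'C(|T|, 2) of the minimum is an upper bound of all edit
   distances between graphs on T (edit_le below), so it plays no role as soon
   as the class contains a graph on T (dist_attained below). *)
Definition dist (P : graph_class) (T : finType) (G : sgraph T) : nat :=
  \big[Order.min/'C(#|T|, 2)]_(F : sgraph T | P T F) edit F G.

Definition dist_max (P : graph_class) (n : nat) : nat :=
  \max_(G : sgraph 'I_n) dist P G.

Lemma edit_le (T : finType) (F G : sgraph T) : (edit F G <= 'C(#|T|, 2))%N.
Proof.
have sub2 (K : sgraph T) : edges K \subset [set e : {set T} | #|e| == 2]%SET.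
  by case: K => E /= /forall_inP HE; apply/fintype.subsetP => e /HE; rewrite inE.
rewrite /edit -card_draws; apply: subset_leq_card.
by rewrite finset.subUset !(fintype.subset_trans (finset.subsetDl _ _) (sub2 _)).
Qed.

Lemma dist_attained (P : graph_class) (T : finType) (G : sgraph T) :
  (exists F, P T F) ->
  (exists2 F, P T F & dist P G = edit F G) /\
  (forall F, P T F -> (dist P G <= edit F G)%N).
Proof.
move=> [F0 PF0]; split=> [|F PF].
  have [//|F PF FE] := @eq_bigmin _ nat (sgraph T) 'C(#|T|, 2)%N F0 (P T) (fun F => edit F G) PF0.
    by move=> F _; exact: edit_le.
  by exists F.
by rewrite -leEnat; apply: bigmin_le_cond.
Qed.

Section EditDistance.
Variable R : realType.

Definition gnp_prob (n : nat) (p : R) (A : pred (sgraph 'I_n)) : R :=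
  \sum_(G : sgraph 'I_n | A G)
     p ^+ #|edges G| * (1 - p) ^+ ('C(n, 2) - #|edges G|).

Definition has_dstar (P : graph_class) (d : R) : Prop :=
  ((dist_max P n)%:R / ('C(n, 2))%:R : R) @[n --> \oo] --> d.

(* The o(n^2) error "with high probability": for each eps > 0, the
   probability of an error at most eps n^2 tends to 1. *)
Definition is_pstar (P : graph_class) (p : R) : Prop :=
  0 <= p <= 1 /\
  forall eps : R, 0 < eps ->
    gnp_prob p (fun G : sgraph 'I_n =>
      `|(dist_max P n)%:R - (dist P G)%:R| <= eps * n%:R ^+ 2) @[n --> \oo] --> (1 : R).

End EditDistance.

Inductive vcolor := VWhite | VBlack.
Inductive ecolor := EWhite | EGray | EBlack.

(* Only the values of ecol at distinct vertices are meaningful. *)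
Record crg (k : nat) := CRG {
  vcol : 'I_k -> vcolor;
  ecol : 'I_k -> 'I_k -> ecolor;
  ecol_sym : forall u v, ecol u v = ecol v u
}.

Section CRGFunction.
Variable R : realType.

Definition crg_mx (k : nat) (K : crg k) (p : R) : 'M[R]_k :=
  \matrix_(u, v)
    if u == v then
      match vcol K u with VWhite => p | VBlack => 1 - p end
    else
      match ecol K u v with EWhite => p | EBlack => 1 - p | EGray => 0 end.

Definition quad (k : nat) (M : 'M[R]_k) (u : 'cV[R]_k) : R :=
  (u^T *m M *m u) ord0 ord0.

Definition simplex (k : nat) : set 'cV[R]_k :=
  [set u | (forall i, 0 <= u i ord0) /\ \sum_i u i ord0 = 1].

(* The infimum is a minimum when k > 0 (crg_g_attained below). *)
Definition crg_g (k : nat) (K : crg k) (p : R) : R :=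
  inf [set quad (crg_mx K p) u | u in @simplex k].

Lemma crg_g_attained (k : nat) (K : crg k) (p : R) : (0 < k)%N ->
  (exists2 u, simplex u & crg_g K p = quad (crg_mx K p) u) /\
  (forall u, simplex u -> crg_g K p <= quad (crg_mx K p) u).
Proof.
move=> k_gt0; set M := crg_mx K p.
have quadE (v : 'rV[R]_k) :
    quad M v^T = \sum_j (\sum_i v ord0 i * M i j) * v ord0 j.
  rewrite /quad trmxK mxE; apply: eq_bigr => j _.
  by rewrite !mxE.
pose A : set 'rV[R]_k := [set v | simplex v^T].
have coordc i : continuous (fun v : 'rV[R]_k => v ord0 i).
  exact: coord_continuous.
have sumc (F : 'I_k -> 'rV[R]_k -> R) : (forall i, continuous (F i)) ->
    continuous (fun v => \sum_i F i v).
  by move=> Fc; apply: continuous_big => // -[x y]; exact: add_continuous.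
have Asum (v : 'rV[R]_k) : A v ->
    (forall i, 0 <= v ord0 i) /\ \sum_i v ord0 i = 1.
  move=> [v0 v1]; split=> [i|]; first by have := v0 i; rewrite mxE.
  by rewrite -v1; apply: eq_bigr => i _; rewrite mxE.
have Ac : compact A.
  have -> : A = [set v : 'rV[R]_k | forall i, v ord0 i \in `[0, 1]] `&`
      [set v : 'rV[R]_k | \sum_i v ord0 i = 1].
    apply/seteqP; split=> [v /Asum[v0 v1]|v [v01 /= v1]]; split => //=.
    - move=> i; rewrite in_itv/= v0/= -v1 (bigD1 i)//= lerDl.
      by apply: sumr_ge0 => j _; exact: v0.
    - by move=> i; rewrite mxE; have := v01 i; rewrite in_itv => /andP[].
    - by rewrite -v1; apply: eq_bigr => i _; rewrite mxE.
  have cube : compact [set v : 'rV[R]_k | forall i, v ord0 i \in `[0, 1]].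
    exact: (@rV_compact R k (fun=> `[0, 1]%classic)
                            (fun=> @segment_compact R 0 1)).
  apply: compact_closedI cube _.
  apply: (@preimage_closed _ _ (fun v : 'rV[R]_k => \sum_i v ord0 i) [set 1]).
    by move=> v _; exact: (sumc (fun i v => v ord0 i) coordc v).
  exact: closed_eq.
have A0 : A !=set0.
  exists (delta_mx ord0 (Ordinal k_gt0)); split=> [i|].
    by rewrite !mxE; exact: ler0n.
  rewrite (bigD1 (Ordinal k_gt0)) //= big1 => [|i /negbTE ni].
    by rewrite !mxE !eqxx addr0.
  by rewrite !mxE ni andbF.
have fc : continuous (fun v : 'rV[R]_k => quad M v^T).
  have -> : (fun v : 'rV[R]_k => quad M v^T) =
      (fun v => \sum_j (\sum_i v ord0 i * M i j) * v ord0 j).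
    by apply/funext => v; exact: quadE.
  have ic j : continuous (fun w : 'rV[R]_k => \sum_i w ord0 i * M i j).
    apply: (sumc (fun i w => w ord0 i * M i j)) => i w.
    exact: (cvgM (coordc i w) (cvg_cst (M i j))).
  apply: (sumc (fun j v => (\sum_i v ord0 i * M i j) * v ord0 j)) => j v.
  exact: (cvgM (ic j v) (coordc j v)).
have [v /set_mem Av vmin] := compact_EVT_min A0 Ac (continuous_subspaceT fc).
have min u : simplex u -> quad M v^T <= quad M u.
  by move=> su; rewrite -(trmxK u); apply: vmin; rewrite inE /A /= trmxK.
have gE : crg_g K p = quad M v^T.
  apply/eqP; rewrite eq_le; apply/andP; split.
    apply: ge_inf; last by exists v^T.
    by exists (quad M v^T) => _ [u su <-]; exact: min.
  apply: lb_le_inf; first by exists (quad M v^T), v^T.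
  by move=> _ [u su <-]; exact: min.
by split; [exists v^T | rewrite gE].
Qed.

Definition local_max01 (f : R -> R) (p : R) : Prop :=
  0 <= p <= 1 /\ \forall q \near p, 0 <= q <= 1 -> f q <= f p.

End CRGFunction.

Lemma K33_subproof :
  [forall e in [set [set inl i; inr j] | i in 'I_3, j in 'I_3]%SET
    : {set {set 'I_3 + 'I_3}}, #|e| == 2].
Proof. by apply/forall_inP => _ /imset2P[i j _ _ ->]; rewrite cards2. Qed.

Definition K33 : sgraph ('I_3 + 'I_3)%type := SGraph K33_subproof.

Definition Kprime : crg 3 :=
  @CRG 3 (fun v => if v == ord0 then VWhite else VBlack)
         (fun _ _ => EGray) (fun _ _ => erefl).

(* Main.v *)
Require Import Defs.
From mathcomp Require Import all_boot all_order all_algebra.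
From mathcomp Require Import all_classical all_reals all_analysis.
From mathcomp Require Import ring lra zify.
Set Implicit Arguments.
Unset Strict Implicit.
Unset Printing Implicit Defensive.
Import Order.TTheory GRing.Theory Num.Theory.
Import numFieldNormedType.Exports.
Local Open Scope ring_scope.

(** Put p = sqrt 2 - 1, so that p^2 + 2 p = 1 and p^2 = 3 - 2 sqrt 2.

    Upper bound.  Give the vertices of a graph independent random labels 0, 1, 2,
    delete all edges inside class 0 and add all edges inside classes 1 and 2.  The
    outcome never contains an induced K33 ([homogenise_free]): two vertices on
    the same side of a copy are not adjacent, so they do not share a nonzero
    label, so some vertex on either side has label 0, and these two would be
    adjacent inside class 0.  With label weights (1-r)/(1+r), r/(1+r), r/(1+r) a
    graph of edge density r changes in a proportion r(1-r)/(1+r) of its pairs on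
    average ([dist_le_density]).  This is the value of g_K' at r, and its only
    maximum on [0, 1] is p^2, at r = p.  With the weights of r = p the average
    is p^2 C(n,2) whatever the density, hence Dist(n) <= p^2 C(n,2).

    Lower bound.  Let G be quasirandom of density p and let F have no induced K33.
    Weak regularity replaces F by a step function D that is close to it in cut
    norm ([weak_regularity]).  Colour a pair white, black or gray when D is near
    0, near 1, or neither: relative to G, which has density p on every block, these
    pairs cost p, 1-p and 0 edits.  By the counting lemma, few maps of K33 into
    the vertices send edges to nonwhite and nonedges to nonblack pairs, so a
    random sample of m vertices usually contains none, and the cost of F is at
    least that of the sample ([edit_lower_bound]).

    What is left is an extremal problem on m points
    ([three_colour_cost_ge]): three-coloured pairs without such a pattern
    cost at least (p^2 - o(1)) m^2, counting ordered pairs.  Take a maximal packing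
    of white cliques of a fixed large size, let A be their union and D the rest,
    which has no large white clique.  Almost all pairs in A are white, by
    Kovari-Sos-Turan between the cliques.  In D there are few gray triangles, since
    each of their vertices could be doubled by a nonwhite twin and six such
    vertices make a pattern; so by Mantel at most about half of the pairs in D are
    gray.  For most a in A, few triples of nonwhite neighbours of a in D are pairwise
    nonblack, because three mutually white points of A attached to such a triple
    make a pattern; so by Mantel about half of the pairs of neighbours are black.
    The resulting quadratic form in the sizes of A, D and the neighbourhoods has
    minimum p^2 ([split_cost]).

    Random graphs.  With high probability G(n, r) is quasirandom of density r, by a
    second moment bound on signed 4-cycles ([quasirandom_whp]).  For r = p the
    lower bound applies, so Dist(G(n, p)) and Dist(n) are both p^2 n^2/2 + o(n^2);
    for r <> p the upper bound at density r is below p^2 by a constant, so r fails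
    the definition of p*. *)

(** * Sums, Turan and Mantel *)

Ltac le_by_ring := rewrite le_eqVlt; apply/orP; left; apply/eqP; ring.

Ltac split_ands := repeat match goal with
  | H : is_true (_ && _) |- _ => move/andP: H => [? ?] end.

Lemma sqr_sum_le (R : realFieldType) (X : finType) (A : pred X) (f : X -> R) :
  (\sum_(x | A x) f x) ^+ 2 <= #|A|%:R * \sum_(x | A x) f x ^+ 2.
Proof.
set S := \sum_(x | A x) f x; set N : R := #|A|%:R.
(* [N] times the variance of [f]. *)
have : 0 <= \sum_(x | A x) (N * f x - S) ^+ 2.
  by apply: sumr_ge0 => x _; exact: sqr_ge0.
have -> : \sum_(x | A x) (N * f x - S) ^+ 2 =
    N * (N * \sum_(x | A x) f x ^+ 2 - S ^+ 2).
  have -> : \sum_(x | A x) (N * f x - S) ^+ 2 =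
      \sum_(x | A x) (N ^+ 2 * f x ^+ 2 - (2 * N * S) * f x + S ^+ 2).
    by apply: eq_bigr => x _; ring.
  rewrite big_split sumrB -!mulr_sumr -/S /= sumr_const -mulr_natl.
  by rewrite -/N; ring.
have [N0|N0] := eqVneq N 0; last first.
  have N_gt0 : 0 < N by rewrite lt_neqAle eq_sym N0 ler0n.
  by rewrite pmulr_rge0 // subr_ge0.
rewrite N0 !mul0r /S big1 ?expr0n// => x Ax.
move/eqP: N0; rewrite /N pnatr_eq0 => /eqP/card0_eq/(_ x).
by rewrite -topredE /= Ax inE.
Qed.

(** [r] is reflexive, so the right-hand side also counts the pairs [(x, x)].
    Induction on [s]: if [x] has least degree [d], its [d] neighbours in [X]
    have degree at least [d], and an independent subset of the rest has at most
    [s] - 1 elements, because [x] could be added to it. *)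
Lemma turan (V : finType) (r : rel V) (s : nat) (X : {set V}) :
  reflexive r -> symmetric r ->
  (forall I : {set V}, I \subset X ->
     (forall x y, x \in I -> y \in I -> x != y -> ~~ r x y) -> (#|I| <= s)%N) ->
  (#|X| ^ 2 <= s * \sum_(x in X) \sum_(y in X) r x y)%N.
Proof.
move=> rr rs; elim: s X => [|s IH] X hX.
  have X0 : X = finset.set0.
    case: (set_0Vmem X) => [->|[x xX]]//.
    have := hX [set x]%SET; rewrite finset.sub1set => /(_ xX).
    rewrite cards1 ltnn => H.
    by exfalso; suff : false by []; apply: H => y z; rewrite !inE => /eqP-> /eqP->;
      rewrite eqxx.
  by rewrite X0 cards0.
have [->|[x0 x0X]] := set_0Vmem X; first by rewrite cards0.
pose d x := (\sum_(y in X) r x y)%N.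
have [x xX xmin] := @arg_minnP _ x0 [pred y in X] d x0X.
rewrite inE in xX.
set N := [set y in X | r x y]%SET.
have NX : N \subset X by apply/fintype.subsetP => y; rewrite inE => /andP[].
have cN : #|N| = d x.
  rewrite /d -sum1_card big_mkcond /= [in RHS]big_mkcond /=.
  by apply: eq_bigr => y _; rewrite inE; case: (y \in X) => //=; case: (r x y).
have /IH IH' : forall I : {set V}, I \subset (X :\: N)%SET ->
    (forall x y, x \in I -> y \in I -> x != y -> ~~ r x y) -> (#|I| <= s)%N.
  move=> I /fintype.subsetP IX Ii.
  have xI : x \notin I by apply/negP => /IX; rewrite !inE xX rr.
  have Hn : #|x |: I|%SET = #|I|.+1 by rewrite cardsU1 xI.
  have H : (#|x |: I|%SET <= s.+1)%N; last by rewrite Hn ltnS in H.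
  apply: hX.
    apply/fintype.subsetP => y; rewrite !inE => /orP[/eqP->//|/IX].
    by rewrite !inE => /andP[].
  have key y : y \in I -> ~~ r x y.
    by move/IX; rewrite !inE => /andP[] /[swap] ->.
  move=> y z; rewrite !inE => /orP[/eqP->|yI] /orP[/eqP->|zI].
  - by rewrite eqxx.
  - by move=> _; exact: key.
  - by move=> _; rewrite rs; exact: key.
  - exact: Ii.
have eE : (\sum_(y in N) d y + \sum_(y in X :\: N) d y =
           \sum_(y in X) \sum_(z in X) r y z)%N.
  rewrite -/(d _) [RHS](bigID (mem N)) /=; congr (_ + _)%N; apply: eq_bigl => y.
    rewrite andb_idl// => yN; exact: (fintype.subsetP NX).
  by rewrite !inE andbC.
have e1 : (d x * d x <= \sum_(y in N) d y)%N.
  rewrite -{1}cN -sum_nat_const; apply: leq_sum => y yN.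
  by apply: xmin; rewrite inE; exact: (fintype.subsetP NX).
have e2 : (\sum_(y in X :\: N) \sum_(z in X :\: N) r y z
           <= \sum_(y in X :\: N) d y)%N.
  apply: leq_sum => y _; rewrite /d [leqLHS]big_mkcond [leqRHS]big_mkcond /=.
  by apply: leq_sum => z _; rewrite inE; case: (z \in X); case: (z \in N).
have cD : (#|X| = d x + #|X :\: N|%SET)%N.
  by rewrite cardsD (finset.setIidPr NX) -cN subnKC ?subset_leq_card.
move: e1 e2 IH'; rewrite -eE cD.
set a := (\sum_(y in N) _)%N; set b := (\sum_(y in _) d y)%N.
set c := (\sum_(y in _) _)%N; set m := #|_|; set k := d x => e1 e2 e3.
have e4 : (m ^ 2 <= s * b)%N by apply: leq_trans e3 _; rewrite leq_mul2l e2 orbT.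
case: (posnP s) => [s0|s0]; first by subst s; nia.
rewrite -(leq_pmul2l s0).
have : (s * (k + m) ^ 2 <= s * s.+1 * (k * k) + s.+1 * m ^ 2)%N.
  case: (nat_Cauchy (s * k)%N m) => + _; clear; nia.
nia.
Qed.

Definition npairs (R : realFieldType) (V : finType) (r : rel V) (X : pred V) : R :=
  \sum_(x | X x) \sum_(y | X y) (r x y)%:R.

Definition ntriangles (R : realFieldType) (V : finType) (r : rel V)
    (X : pred V) : R :=
  \sum_(x | X x) \sum_(y | X y) \sum_(z | X z) (r x y && r x z && r y z)%:R.

(** The ends of an edge [x y] have at least [d x + d y - #|X|] common neighbours;
    sum over all edges and apply Cauchy-Schwarz to the degrees.  In this form a
    small number of triangles still bounds the number of edges. *)
Lemma mantel (R : realFieldType) (V : finType) (r : rel V) (X : pred V) :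
  symmetric r ->
  npairs R r X * (2 * npairs R r X - #|X|%:R ^+ 2) <= #|X|%:R * ntriangles R r X.
Proof.
move=> rs; set e := npairs R r X; set t := ntriangles R r X.
set n : R := #|X|%:R.
pose d x : R := \sum_(y | X y) (r x y)%:R.
have d2 : \sum_(x | X x) \sum_(y | X y) (r x y)%:R * d x = \sum_(x | X x) d x ^+ 2.
  by apply: eq_bigr => x _; rewrite -mulr_suml expr2.
have d2' : \sum_(x | X x) \sum_(y | X y) (r x y)%:R * d y = \sum_(x | X x) d x ^+ 2.
  rewrite exchange_big -d2 /=; apply: eq_bigr => x _; apply: eq_bigr => y _.
  by rewrite rs.
have ht : 2 * \sum_(x | X x) d x ^+ 2 - n * e <= t.
  have -> : 2 * \sum_(x | X x) d x ^+ 2 - n * e =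
     \sum_(x | X x) \sum_(y | X y) (r x y)%:R * (d x + d y - n).
    rewrite mulr_natl mulr2n -{1}d2 -d2' -big_split /= mulr_sumr -sumrB.
    apply: eq_bigr => x _; rewrite -big_split /= mulr_sumr -sumrB.
    by apply: eq_bigr => y _; ring.
  apply: ler_sum => x _; apply: ler_sum => y _.
  rewrite /d /n -big_split /= -sum1_card natr_sum -sumrB mulr_sumr.
  apply: ler_sum => z _.
  by case: (r x y); case: (r x z); case: (r y z); rewrite /= ?mulr0 ?mul0r ?mul1r//; lra.
have de : \sum_(x | X x) d x = e by [].
have := sqr_sum_le X d; rewrite de -/n => h.
have n0 : 0 <= n by exact: ler0n.
have : n * (2 * \sum_(x | X x) d x ^+ 2 - n * e) <= n * t by rewrite ler_wpM2l.
nra.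
Qed.

(** * Three-coloured pairs without a K33 pattern *)

(** Here [p + 1] is the square root of 2.  For [2 * alpha >= p * delta] the right-hand
    side decreases in [c], and at [c = delta] the difference of the two sides is a
    multiple of [((p + 1) * alpha - delta) ^+ 2].  Otherwise the minimum over all
    [c], reached at [c = 2 * alpha / p], leaves room to spare. *)
Lemma cost_form_ge (R : realFieldType) (p alpha delta c : R) :
  0 < p -> p ^+ 2 + 2 * p = 1 -> 0 <= alpha -> 0 <= c -> c <= delta ->
  p ^+ 2 * (alpha + delta) ^+ 2 <=
  p * (alpha ^+ 2 + 2 * alpha * (delta - c) + delta ^+ 2 / 2) + p ^+ 2 * (c ^+ 2 / 2).
Proof.
move=> p0 pE a0 c0 cd.
have p1 : p < 42 / 100 by nra.
have p2 : 41 / 100 < p by nra.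
have d0 : 0 <= delta by lra.
have p2E : p ^+ 2 = 1 - 2 * p by lra.
have [h|h] := leP (p * delta) (2 * alpha).
  have h1 : 0 <= (delta - c) * (2 * alpha - p * (delta + c) / 2).
    apply: mulr_ge0; first by lra.
    nra.
  have h3 : 0 <= p * ((delta - c) * (2 * alpha - p * (delta + c) / 2)).
    by rewrite mulr_ge0// ltW.
  have p3E : p ^+ 3 = 5 * p - 2 by rewrite exprS p2E; lra.
  have h4 : 0 <= (3 * p - 1) / 2 * ((p + 1) * alpha - delta) ^+ 2.
    by rewrite mulr_ge0 ?sqr_ge0//; lra.
  have e1 : p ^+ 2 * alpha ^+ 2 = (1 - 2 * p) * alpha ^+ 2 by rewrite p2E.
  have e2 : p ^+ 3 * alpha ^+ 2 = (5 * p - 2) * alpha ^+ 2 by rewrite p3E.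
  have e3 : p ^+ 2 * (alpha * delta) = (1 - 2 * p) * (alpha * delta) by rewrite p2E.
  have e4 : p ^+ 2 * delta ^+ 2 = (1 - 2 * p) * delta ^+ 2 by rewrite p2E.
  lra.
have t0 : 0 <= alpha * delta by rewrite mulr_ge0.
have t1 : 0 <= (p - 41 / 100) * alpha ^+ 2 by rewrite mulr_ge0 ?sqr_ge0//; lra.
have t2 : 0 <= (p - 41 / 100) * (alpha * delta) by rewrite mulr_ge0//; lra.
have t3 : 0 <= (p - 41 / 100) * delta ^+ 2 by rewrite mulr_ge0 ?sqr_ge0//; lra.
have t4 : alpha * (2 * alpha) <= alpha * (42 / 100 * delta).
  by rewrite ler_wpM2l//; have := ler_wpM2r d0 (ltW p1); lra.
have t5 := sqr_ge0 delta.
have h2 : 0 <= (p * c - 2 * alpha) ^+ 2 by exact: sqr_ge0.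
have e1 : p ^+ 2 * alpha ^+ 2 = (1 - 2 * p) * alpha ^+ 2 by rewrite p2E.
have e3 : p ^+ 2 * (alpha * delta) = (1 - 2 * p) * (alpha * delta) by rewrite p2E.
have e4 : p ^+ 2 * delta ^+ 2 = (1 - 2 * p) * delta ^+ 2 by rewrite p2E.
lra.
Qed.

(** In the application [alpha] and [delta] are the sizes of the two parts, [S] is
    the number of nonwhite pairs across, [NB] the number of black pairs in the
    second part and [t] the error term.  If [alpha] is less than a twentieth of the
    total, nongray pairs in the second part already cost
    [p / 2 * (19 / 20) ^+ 2 > p ^+ 2]; otherwise one may divide by [alpha] and use
    [cost_form_ge] with [c] the mean number of nonwhite neighbours. *)
Lemma split_cost (R : realFieldType) (p alpha delta t S NB W B : R) :
  0 < p -> p ^+ 2 + 2 * p = 1 -> 0 <= alpha -> 0 <= delta -> 0 <= t ->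
  0 <= S -> S <= alpha * delta -> 0 <= NB -> NB <= B ->
  alpha ^+ 2 + 2 * (alpha * delta - S) + delta ^+ 2 / 2 - NB - 5 * t <= W ->
  S ^+ 2 / 2 <= alpha * (alpha * (NB + 2 * t) + t * (alpha + delta)) ->
  p ^+ 2 * (alpha + delta) ^+ 2 - 26 * t <= p * W + (1 - p) * B.
Proof.
move=> p0 pE a0 d0 t0 S0 Sad NB0 NBB Wlo bl.
set M := alpha + delta in bl *.
have p1 : p < 42 / 100 by clear -p0 pE; nra.
have lo1 : p * (alpha ^+ 2 + 2 * (alpha * delta - S) + delta ^+ 2 / 2) +
    p ^+ 2 * NB - 3 * t <= p * W + (1 - p) * B.
  have e1 := ler_wpM2l (ltW p0) Wlo.
  have e2 : (1 - p) * NB <= (1 - p) * B.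
    by apply: ler_wpM2l NBB; clear -p1; lra.
  have e3 : p ^+ 2 * NB = (1 - 2 * p) * NB by congr (_ * _); clear -pE; lra.
  have e4 : p * (5 * t) <= 3 * t.
    by have := ler_wpM2r t0 (ltW p1); clear -t0; lra.
  rewrite e3; clear -e1 e2 e4; lra.
apply: le_trans lo1.
have [ha|ha] := leP (M / 20) alpha; last first.
  have h1 : 0 <= p * (alpha ^+ 2 + 2 * (alpha * delta - S)).
    by apply: mulr_ge0 (ltW p0) _; have := sqr_ge0 alpha; clear -Sad; lra.
  have h2 : 0 <= p ^+ 2 * NB by rewrite mulr_ge0// sqr_ge0.
  have h3 : (19 / 20 * M) ^+ 2 <= delta ^+ 2.
    by rewrite lerXn2r// ?nnegrE//; clear -ha a0 d0; rewrite /M in ha *; lra.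
  have h4 : p * (p * M ^+ 2) <= p * (delta ^+ 2 / 2).
    apply: ler_wpM2l (ltW p0) _ _ _.
    have := ler_wpM2r (sqr_ge0 M) (ltW p1); have := sqr_ge0 M.
    have g2 : (19 / 20 * M) ^+ 2 = 361 / 400 * M ^+ 2 by field.
    by move: h3; rewrite g2; clear; lra.
  have h5 : p ^+ 2 * M ^+ 2 = p * (p * M ^+ 2) by ring.
  rewrite h5; clear -h1 h2 h4 t0; lra.
have [a_eq|ap] := leP alpha 0.
  have aE : alpha = 0 by apply/eqP; rewrite eq_le a_eq a0.
  have dE : delta = 0 by clear -ha aE d0; rewrite /M in ha; lra.
  rewrite /M aE dE !(addr0, mul0r, mulr0, expr0n) /=.
  have := mulr_ge0 (sqr_ge0 p) NB0; have SE : S = 0.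
    by apply/eqP; rewrite eq_le S0 andbT; move: Sad; rewrite aE mul0r.
  by rewrite SE; clear -t0; lra.
pose c := S / alpha.
have SE : S = c * alpha by rewrite /c divfK// gt_eqF.
have c0 : 0 <= c by rewrite /c divr_ge0.
have cd : c <= delta by rewrite /c ler_pdivrMr// mulrC.
have cf := cost_form_ge p0 pE a0 c0 cd.
have NBlo : c ^+ 2 / 2 <= NB + 22 * t.
  have a2 : 0 < alpha ^+ 2 by rewrite exprn_gt0.
  rewrite -(ler_pM2l a2).
  have -> : alpha ^+ 2 * (c ^+ 2 / 2) = S ^+ 2 / 2 by rewrite SE; field.
  apply: le_trans bl _.
  have g1 : alpha * (t * M) <= alpha * (alpha * (20 * t)).
    by apply: ler_wpM2l a0 _ _ _; have := ler_wpM2r t0 ha; clear; lra.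
  by clear -g1; lra.
have g2 := ler_wpM2l (sqr_ge0 p) NBlo.
have p2 : p ^+ 2 <= 1 by clear -pE p0; lra.
have g3 : p ^+ 2 * t <= t by rewrite ler_piMl.
have -> : 2 * (alpha * delta - S) = 2 * alpha * (delta - c) by rewrite SE; ring.
rewrite -/M in cf; clear -cf g2 g3 t0; lra.
Qed.

Section ThreeColour.
Context (R : realFieldType) (V : finType) (w b : rel V).
Hypothesis w_sym : symmetric w.
Hypothesis b_sym : symmetric b.
Hypothesis w_b : forall x y, w x y -> ~~ b x y.

(** White pairs can only be nonadjacent, black pairs only adjacent, gray pairs
    either: [x] and [y] are the sides of a copy of K33 that the colours permit. *)
Definition K33_pattern (x y : seq V) : bool :=
  [&& size x == 3, size y == 3, uniq (x ++ y),
      allrel (fun u v => ~~ w u v) x y,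
      pairwise (fun u v => ~~ b u v) x & pairwise (fun u v => ~~ b u v) y].

Hypothesis free : forall x y, ~~ K33_pattern x y.

Definition gray x y := [&& x != y, ~~ w x y & ~~ b x y].

(** An equal pair counts as a twin so that Turan's bound needs no correction
    for the diagonal; such degenerate pairs are discarded at the very end. *)
Definition twin x y := (x == y) || ~~ w x y.
Definition white_clique (I : {set V}) :=
  [forall x in I, forall y in I, (x != y) ==> w x y].

Lemma gray_sym : symmetric gray.
Proof. by move=> x y; rewrite /gray eq_sym w_sym b_sym. Qed.

Lemma twin_sym : symmetric twin.
Proof. by move=> x y; rewrite /twin eq_sym w_sym. Qed.

Let m : R := #|V|%:R.

Section NoLargeWhiteClique.
Context (D : pred V) (s : nat).
Hypothesis D_clique : forall I : {set V}, I \subset D -> white_clique I -> (#|I| <= s)%N.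

(** Cauchy-Schwarz over [y], then Turan for the twin relation on each [f y], where
    an independent set is a white clique. *)
Lemma twin_doubling (Y : finType) (f : Y -> pred V) :
  (forall y x, f y x -> D x) ->
  (\sum_y \sum_x (f y x)%:R : R) ^+ 2 <=
  s%:R * #|Y|%:R * \sum_y \sum_x \sum_x' ([&& f y x, f y x' & twin x x'])%:R.
Proof.
move=> fD; have := sqr_sum_le predT (fun y => \sum_x (f y x)%:R : R).
move=> /le_trans; apply; rewrite -[in leRHS]mulrA [in leRHS]mulrCA.
rewrite ler_wpM2l// mulr_sumr; apply: ler_sum => y _.
pose X := [set x | f y x]%SET.
have tT := @turan V twin s X.
have {tT} : (#|X| ^ 2 <= s * \sum_(x in X) \sum_(x' in X) twin x x')%N.
  apply: tT.
  - by move=> x; rewrite /twin eqxx.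
  - exact: twin_sym.
  move=> I /fintype.subsetP IX It; apply: D_clique.
    by apply/fintype.subsetP => x /IX; rewrite inE => /fD.
  apply/forall_inP => x xI; apply/forall_inP => x' x'I; apply/implyP => xx'.
  by have := It _ _ xI x'I xx'; rewrite /twin negb_or negbK => /andP[].
have -> : #|X| = (\sum_x f y x)%N.
  by rewrite -sum1_card big_mkcond; apply: eq_bigr => x _; rewrite inE; case: (f y x).
have -> : (\sum_(x in X) \sum_(x' in X) twin x x' =
  \sum_x \sum_x' [&& f y x, f y x' & twin x x'])%N.
  rewrite big_mkcond; apply: eq_bigr => x _; rewrite inE.
  case: (f y x) => /=; last by rewrite big1.
  rewrite big_mkcond; apply: eq_bigr => x' _; rewrite inE.
  by case: (f y x').
rewrite -(ler_nat R) natrX natrM natr_sum [in leRHS]natr_sum => /le_trans; apply.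
by rewrite ler_wpM2l//; apply: ler_sum => x _; rewrite natr_sum.
Qed.

Lemma twin_doubling2 (f : V -> V -> pred V) :
  (forall u v x, f u v x -> D x) ->
  (\sum_u \sum_v \sum_x (f u v x)%:R : R) ^+ 2 <=
  s%:R * m ^+ 2 * \sum_u \sum_v \sum_x \sum_x' ([&& f u v x, f u v x' & twin x x'])%:R.
Proof.
move=> fD; have := @twin_doubling (V * V)%type (fun y => f y.1 y.2).
rewrite card_prod natrM -expr2 -/m.
rewrite -(pair_bigA _ (fun u v => \sum_x (f u v x)%:R)) /=.
rewrite -(pair_bigA _ (fun u v => \sum_x \sum_x' ([&& f u v x,
  f u v x' & twin x x'])%:R)) /=.
by apply=> -[u v] x /=; exact: fD.
Qed.

Lemma twin_doubling3 (f : V -> V -> V -> pred V) :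
  (forall u v t x, f u v t x -> D x) ->
  (\sum_u \sum_v \sum_t \sum_x (f u v t x)%:R : R) ^+ 2 <=
  s%:R * m ^+ 3 * \sum_u \sum_v \sum_t \sum_x \sum_x' ([&& f u v t x,
    f u v t x' & twin x x'])%:R.
Proof.
move=> fD; have := @twin_doubling (V * (V * V))%type (fun y => f y.1 y.2.1 y.2.2).
rewrite !card_prod !natrM -expr2 -exprS -/m.
rewrite -(pair_bigA _ (fun u (v : V * V) => \sum_x (f u v.1 v.2 x)%:R)) /=.
rewrite -(pair_bigA _ (fun u (v : V * V) => \sum_x \sum_x' ([&& f u v.1 v.2 x,
  f u v.1 v.2 x' & twin x x'])%:R)) /=.
under eq_bigr => u _ do rewrite -(pair_bigA _ (fun v t => \sum_x (f u v t x)%:R)) /=.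
under [in leRHS]eq_bigr => u _ do rewrite -(pair_bigA _ (fun v t =>
  \sum_x \sum_x' ([&& f u v t x, f u v t x' & twin x x'])%:R)) /=.
by apply=> -[u [v t]] x /=; exact: fD.
Qed.

Lemma twin_doubling4 (f : V -> V -> V -> V -> pred V) :
  (forall u v t z x, f u v t z x -> D x) ->
  (\sum_u \sum_v \sum_t \sum_z \sum_x (f u v t z x)%:R : R) ^+ 2 <=
  s%:R * m ^+ 4 * \sum_u \sum_v \sum_t \sum_z \sum_x \sum_x' ([&& f u v t z x,
    f u v t z x' & twin x x'])%:R.
Proof.
move=> fD; have := @twin_doubling ((V * V) * (V *
  V))%type (fun y => f y.1.1 y.1.2 y.2.1 y.2.2).
have -> : #|{: (V * V) * (V * V)}|%:R = m ^+ 4 by rewrite !card_prod !natrM -/m; ring.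
rewrite -(pair_bigA _ (fun (u v : V * V) => \sum_x (f u.1 u.2 v.1 v.2 x)%:R)) /=.
rewrite -(pair_bigA _ (fun (u v : V * V) => \sum_x \sum_x' ([&& f u.1 u.2 v.1 v.2 x,
  f u.1 u.2 v.1 v.2 x' & twin x x'])%:R)) /=.
rewrite -(pair_bigA _ (fun u v => \sum_(j : V * V) \sum_x (f u v j.1 j.2 x)%:R)) /=.
rewrite -(pair_bigA _ (fun u v => \sum_(j : V * V) \sum_x \sum_x' ([&& f u v j.1 j.2 x,
  f u v j.1 j.2 x' & twin x x'])%:R)) /=.
under eq_bigr => u _ do under eq_bigr => v _ do rewrite -(pair_bigA _ (fun t z =>
  \sum_x (f u v t z x)%:R)) /=.
under [in leRHS]eq_bigr => u _ do under eq_bigr =>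
  v _ do rewrite -(pair_bigA _ (fun t z => \sum_x \sum_x' ([&& f u v t z x,
  f u v t z x' & twin x x'])%:R)) /=.
by apply=> -[[u v] [t z]] x /=; exact: fD.
Qed.

Let gtri a b c := [&& D a, D b, D c, gray a b, gray a c & gray b c].

(** Double the three vertices of a gray triangle one after the other, each by a
    twin that forms gray triangles with the same partners.  If the three twins are
    distinct from their originals, the originals and the twins are the two sides of
    a pattern: a nonwhite matching joins them and all other pairs are gray.  So only
    the at most [3 * m ^+ 5] degenerate sextuples remain. *)
Lemma gray_triangles_few :
  (ntriangles R gray D) ^+ 8 <= 3 * s%:R ^+ 7 * m ^+ 23.
Proof.
pose f2 a b c c' := [&& gtri a b c, gtri a b c' & twin c c'].
pose f3 b c c' a a' := [&& f2 a b c c', f2 a' b c c' & twin a a'].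
pose f4 c c' a a' b b' := [&& f3 b c c' a a', f3 b' c c' a a' & twin b b'].
pose N1 : R := \sum_a \sum_b \sum_c (gtri a b c)%:R.
pose N2 : R := \sum_a \sum_b \sum_c \sum_c' (f2 a b c c')%:R.
pose N3 : R := \sum_b \sum_c \sum_c' \sum_a \sum_a' (f3 b c c' a a')%:R.
pose N4 : R := \sum_c \sum_c' \sum_a \sum_a' \sum_b \sum_b' (f4 c c' a a' b b')%:R.
have h1 : N1 ^+ 2 <= s%:R * m ^+ 2 * N2.
  apply: (@twin_doubling2 gtri) => a' b' c'; by case/and5P.
have h2 : N2 ^+ 2 <= s%:R * m ^+ 3 * N3.
  have -> : N2 = \sum_b \sum_c \sum_c' \sum_a (f2 a b c c')%:R.
    rewrite /N2 exchange_big; apply: eq_bigr => b' _.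
    rewrite exchange_big; apply: eq_bigr => c _.
    by rewrite exchange_big.
  apply: (@twin_doubling3 (fun b c c' a => f2 a b c c')) => b' c c' a.
  by rewrite /f2 /gtri => /andP[/andP[]].
have h3 : N3 ^+ 2 <= s%:R * m ^+ 4 * N4.
  have -> : N3 = \sum_c \sum_c' \sum_a \sum_a' \sum_b (f3 b c c' a a')%:R.
    rewrite /N3 exchange_big; apply: eq_bigr => c _.
    rewrite exchange_big; apply: eq_bigr => c' _.
    rewrite exchange_big; apply: eq_bigr => a _.
    by rewrite exchange_big.
  apply: (@twin_doubling4 (fun c c' a a' b => f3 b c c' a a')) => c c' a a' b'.
  by rewrite /f3 /f2 /gtri => /andP[/andP[/and3P[]]].
have h4 : N4 <= 3 * m ^+ 5.
  have -> : 3 * m ^+ 5 = \sum_(c : V) \sum_(c' : V) \sum_(a : V) \sum_(a' : V)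
      \sum_(b : V) \sum_(b' : V) ((c == c')%:R + (a == a')%:R + (b == b')%:R : R).
    have E (x : V) : \sum_(x' : V) (x == x')%:R = 1 :> R.
      rewrite (bigD1 x)//= eqxx big1 ?addr0// => y; rewrite eq_sym.
      by move/negbTE ->.
    have C (r : R) : \sum_(x : V) r = m * r by rewrite sumr_const mulr_natl.
    symmetry.
    under eq_bigr => c _ do under eq_bigr => c' _ do under eq_bigr => a _ do
      under eq_bigr => a' _ do under eq_bigr => b' _ do rewrite big_split /= E C.
    under eq_bigr => c _ do under eq_bigr => c' _ do under eq_bigr => a _ do
      under eq_bigr => a' _ do rewrite C mulrDr mulrDr mulrDr.
    under eq_bigr => c _ do under eq_bigr => c' _ do under eq_bigr => a _ do
      rewrite !big_split /= -!mulr_sumr E !C.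
    under eq_bigr => c _ do under eq_bigr => c' _ do rewrite C.
    under eq_bigr => c _ do
      rewrite -mulr_sumr !big_split /= -!mulr_sumr E !C.
    by rewrite C; ring.
  apply: ler_sum => c _; apply: ler_sum => c' _; apply: ler_sum => a _.
  apply: ler_sum => a' _; apply: ler_sum => b1 _; apply: ler_sum => b' _.
  rewrite -!natrD ler_nat.
  case: (boolP (f4 _ _ _ _ _ _)) => //.
  have [//|cc'] := eqVneq c c'; have [//|aa'] := eqVneq a a'.
  have [//|bb'] := eqVneq b1 b'; rewrite /f4 /f3 /f2 /gtri /twin.
  rewrite (negbTE cc') (negbTE aa') (negbTE bb') /gray /= => H.
  exfalso; move/negP: (free [:: a; b1; c] [:: a'; b'; c']); apply.
  rewrite /K33_pattern /allrel /= !inE !negb_or; split_ands.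
  by repeat (apply/andP; split);
    first [done | rewrite eq_sym; done | rewrite w_sym; done | rewrite b_sym; done].
have s0 : 0 <= (s%:R : R) by exact: ler0n.
have m0 : 0 <= m by exact: ler0n.
have N3_ge0 : 0 <= N3 by do 5!(apply: sumr_ge0 => ? _); exact: ler0n.
have N2_ge0 : 0 <= N2 by do 4!(apply: sumr_ge0 => ? _); exact: ler0n.
have N1_ge0 : 0 <= N1 by do 3!(apply: sumr_ge0 => ? _); exact: ler0n.
have -> : ntriangles R gray D = N1.
  rewrite /ntriangles big_mkcond; apply: eq_bigr => x _.
  case: ifPn => Dx; last first.
    by rewrite big1 // => y _; rewrite big1 // => z _; rewrite /gtri (negbTE Dx).
  rewrite big_mkcond; apply: eq_bigr => y _.
  case: ifPn => Dy; last by rewrite big1 // => z _; rewrite /gtri (negbTE Dy) andbF.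
  rewrite big_mkcond; apply: eq_bigr => z _.
  by rewrite /gtri Dx Dy -andbA; case: (D z).
have h3' : N3 ^+ 2 <= 3 * s%:R * m ^+ 9.
  apply: le_trans h3 _; have := ler_wpM2l (mulr_ge0 s0 (exprn_ge0 4 m0)) h4.
  by move=> /le_trans; apply; le_by_ring.
have h2' : N2 ^+ 4 <= s%:R ^+ 2 * m ^+ 6 * (3 * s%:R * m ^+ 9).
  have : (N2 ^+ 2) ^+ 2 <= (s%:R * m ^+ 3 * N3) ^+ 2.
    by rewrite lerXn2r// nnegrE ?sqr_ge0// !mulr_ge0// exprn_ge0.
  rewrite -exprM => /le_trans; apply.
  have -> : (s%:R * m ^+ 3 * N3) ^+ 2 = s%:R ^+ 2 * m ^+ 6 * N3 ^+ 2 by ring.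
  by rewrite ler_wpM2l// mulr_ge0// exprn_ge0.
have : (N1 ^+ 2) ^+ 4 <= (s%:R * m ^+ 2 * N2) ^+ 4.
  by rewrite lerXn2r// nnegrE ?sqr_ge0// !mulr_ge0// exprn_ge0.
rewrite -exprM => /le_trans; apply.
have -> : (s%:R * m ^+ 2 * N2) ^+ 4 = s%:R ^+ 4 * m ^+ 8 * N2 ^+ 4 by ring.
have := ler_wpM2l (mulr_ge0 (exprn_ge0 4 s0) (exprn_ge0 8 m0)) h2'.
by move=> /le_trans; apply; le_by_ring.
Qed.

End NoLargeWhiteClique.
Lemma sum_cubeE (T : finType) (A : pred T) (a : T -> R) :
  (\sum_(x | A x) a x) ^+ 3 =
  \sum_(x | A x) \sum_(y | A y) \sum_(z | A z) a x * (a y * a z).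
Proof.
rewrite 2!exprS expr1 mulr_suml; apply: eq_bigr => x _.
rewrite big_distrlr /= mulr_sumr; apply: eq_bigr => y _.
by rewrite mulr_sumr.
Qed.

(** Three distinct points of [Q] have at most two common nonwhite neighbours in
    [Q'], since three would complete a pattern (white pairs are nonblack).  Compare
    with the sum of the cubes of the degrees, as in Kovari-Sos-Turan. *)
Lemma nonwhite_between_cliques (Q Q' : {set V}) (s : nat) (eta : R) :
  white_clique Q -> white_clique Q' -> [disjoint Q & Q'] ->
  #|Q| = s -> #|Q'| = s -> 0 < eta -> 5 <= eta ^+ 3 * s%:R ->
  \sum_(x in Q) \sum_(y in Q') (~~ w x y)%:R <= eta * s%:R ^+ 2.
Proof.
move=> wQ wQ' dQ cQ cQ' eta0 hs; set n : R := s%:R.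
have n0 : 0 < n.
  rewrite lt_def ler0n andbT; apply/eqP => n00.
  by move: hs; rewrite -/n n00 mulr0; lra.
have wc (I : {set V}) x y : white_clique I -> x \in I -> y \in I -> x != y -> ~~ b x y.
  by move=> /forall_inP/(_ x) H /H/forall_inP/(_ y) H' /H'/implyP H'' /H''; exact: w_b.
pose a x y : R := (~~ w x y)%:R.
pose d y := \sum_(x in Q) a x y.
have up : \sum_(y in Q') d y ^+ 3 <= 5 * n ^+ 3.
  under eq_bigr => y _ do rewrite sum_cubeE.
  rewrite exchange_big /=.
  under eq_bigr => x _ do rewrite exchange_big /=.
  under eq_bigr => x _ do under eq_bigr => y _ do rewrite exchange_big /=.
  have E x : x \in Q -> \sum_(y in Q) (x == y)%:R = 1 :> R.
    move=> xQ; rewrite (bigD1 x)//= eqxx big1 ?addr0// => y /andP[_].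
    by rewrite eq_sym => /negbTE ->.
  have C (r : R) : \sum_(x in Q) r = n * r by rewrite sumr_const cQ mulr_natl.
  have -> : 5 * n ^+ 3 = \sum_(x in Q) \sum_(y in Q) \sum_(z in Q)
     (2 + n * ((x == y)%:R + (x == z)%:R + (y == z)%:R)).
    symmetry; rewrite (eq_bigr (fun=> 5 * n ^+ 2)) ?C; first by ring.
    move=> x xQ; rewrite (eq_bigr (fun y => 4 * n + n ^+ 2 * (x == y)%:R)).
      by rewrite big_split /= C -mulr_sumr E//; ring.
    move=> y yQ; rewrite big_split /= C -mulr_sumr !big_split /= C !E//; ring.
  apply: ler_sum => x xQ; apply: ler_sum => y yQ; apply: ler_sum => z zQ.
  have le_n : \sum_(t in Q') a x t * (a y t * a z t) <= n.
    rewrite /n -cQ' -sum1_card natr_sum; apply: ler_sum => t _.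
    by rewrite /a; case: (w x t); case: (w y t); case: (w z t);
      rewrite /= ?mul0r ?mulr0 ?mulr1.
  have [xy|xy] := eqVneq x y; first by apply: le_trans le_n _; rewrite mulr1n; case: eqP;
    case: eqP => _ _ /=; lra.
  have [xz|xz] := eqVneq x z; first by apply: le_trans le_n _; rewrite mulr1n;
    case: eqP => _ /=; lra.
  have [yz|yz] := eqVneq y z; first by apply: le_trans le_n _; rewrite mulr1n/=; lra.
  rewrite !addr0 mulr0 addr0.
  pose Y := [set t in Q' | [&& ~~ w x t, ~~ w y t & ~~ w z t]]%SET.
  have -> : \sum_(t in Q') a x t * (a y t * a z t) = #|Y|%:R.
    rewrite -sum1_card natr_sum big_mkcond [RHS]big_mkcond; apply: eq_bigr => t _.
    rewrite inE; case: (t \in Q') => //=; rewrite /a.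
    by case: (w x t); case: (w y t); case: (w z t); rewrite /= ?mul0r ?mulr0 ?mulr1.
  rewrite (ler_nat R _ 2) leqNgt; apply/negP => /card_gt2P[t1 [t2 [t3 [[]]]]].
  rewrite !inE => /andP[q1 /and3P[? ? ?]] /andP[q2 /and3P[? ? ?]] /andP[q3 /and3P[? ?
    ?]] [? ? ?].
  have nQ u v : u \in Q -> v \in Q' -> u != v.
    by move=> uQ vQ'; apply: contraTneq vQ' => <-; rewrite (disjointFr dQ uQ).
  move/negP: (free [:: x; y; z] [:: t1; t2; t3]); apply.
  rewrite /K33_pattern /allrel /= !inE !negb_or.
  repeat (apply/andP; split);
    first [done | exact: nQ | exact: (wc Q) | exact: (wc Q')
          | by rewrite eq_sym | apply: (wc Q'); by rewrite // eq_sym].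
rewrite exchange_big /= -/(\sum_(y in Q') d y) leNgt; apply/negP => lo.
(* The tangent to the cube at the threshold degree [eta * n]. *)
have tan y : 3 * (eta * n) ^+ 2 * d y - 2 * (eta * n) ^+ 3 <= d y ^+ 3.
  have d0 : 0 <= d y by apply: sumr_ge0 => x _; exact: ler0n.
  have en0 : 0 < eta * n by rewrite mulr_gt0.
  have : 0 <= (d y - eta * n) ^+ 2 * (d y + 2 * (eta * n)).
    by rewrite mulr_ge0 ?sqr_ge0//; lra.
  by rewrite -subr_ge0 => h; rewrite -subr_ge0; apply: le_trans h _; le_by_ring.
have : \sum_(y in Q') (3 * (eta * n) ^+ 2 * d y - 2 * (eta * n) ^+ 3) <= 5 * n ^+ 3.
  by apply: le_trans up; apply: ler_sum => y _.
rewrite sumrB -mulr_sumr sumr_const cQ' -mulr_natl -/n.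
rewrite -/(d _) in lo *.
set e := \sum_(y in Q') d y in lo *.
have en : 0 < 3 * (eta * n) ^+ 2 by rewrite mulr_gt0// exprn_gt0// mulr_gt0.
have := ltr_pM2l en (eta * n ^+ 2) e; rewrite lo => h.
have n3 : 0 < n ^+ 3 by rewrite exprn_gt0.
have := ler_wpM2l (ltW n3) hs; rewrite -/n => h2 h3.
have : 3 * (eta * n) ^+ 2 * (eta * n ^+ 2) < 3 * (eta * n) ^+ 2 * e by [].
nra.
Qed.

Lemma nonwhite_in_cover (P : {set {set V}}) (s : nat) (eta : R) :
  finset.trivIset P -> (forall Q, Q \in P -> white_clique Q && (#|Q| == s)) ->
  0 < eta -> 5 <= eta ^+ 3 * s%:R ->
  npairs R (fun x y => (x != y) && ~~ w x y) (mem (finset.cover P))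
   <= eta * #|finset.cover P|%:R ^+ 2.
Proof.
move=> tP hP eta0 hs; rewrite /npairs.
have cs (F : V -> R) : \sum_(x in finset.cover P) F x = \sum_(Q in P) \sum_(x in Q) F x.
  exact: finset.big_trivIset.
have -> : #|finset.cover P|%:R = \sum_(Q in P) s%:R :> R.
  have /eqP <- : finset.trivIset P by [].
  rewrite natr_sum; apply: eq_bigr => Q /hP/andP[_ /eqP->] //.
have -> : \sum_(x in finset.cover P) \sum_(y in finset.cover P) ((x != y) && ~~ w x y)%:R =
  \sum_(Q in P) \sum_(Q' in P) \sum_(x in Q) \sum_(y in Q') ((x != y) && ~~ w x y)%:R :> R.
  rewrite cs; apply: eq_bigr => Q _; rewrite exchange_big /= cs.
  by apply: eq_bigr => Q' _; rewrite exchange_big.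
have -> : eta * (\sum_(Q in P) s%:R) ^+ 2 =
  \sum_(Q in P) \sum_(Q' in P) eta * s%:R ^+ 2 :> R.
  rewrite expr2 big_distrlr mulr_sumr /=; apply: eq_bigr => Q _.
  by rewrite mulr_sumr; apply: eq_bigr => Q' _; rewrite expr2.
apply: ler_sum => Q QP; apply: ler_sum => Q' Q'P.
have /andP[wQ /eqP cQ] := hP _ QP; have /andP[wQ' /eqP cQ'] := hP _ Q'P.
have [<-|QQ'] := eqVneq Q Q'.
  rewrite big1 ?mulr_ge0 ?sqr_ge0 ?(ltW eta0)// => x xQ; rewrite big1 // => y yQ.
  have [//|xy] := eqVneq x y.
  by move/forall_inP: wQ => /(_ _ xQ)/forall_inP/(_ _ yQ); rewrite xy => /= ->.
have dQ : [disjoint Q & Q'] by move/finset.trivIsetP: tP; apply.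
apply: le_trans (nonwhite_between_cliques wQ wQ' dQ cQ cQ' eta0 hs).
by apply: ler_sum => x _; apply: ler_sum => y _; rewrite ler_nat; case: (x != y).
Qed.

Lemma white_clique_packing (s : nat) : (0 < s)%N -> exists P : {set {set V}},
  [/\ finset.trivIset P, forall Q, Q \in P -> white_clique Q && (#|Q| == s)
    & forall I : {set V}, I \subset ~: finset.cover P -> white_clique I -> (#|I| < s)%N].
Proof.
move=> s0.
pose pr (P : {set {set V}}) := finset.trivIset P && [forall Q in P,
  white_clique Q && (#|Q| == s)].
have [|P /maxsetP[/andP[tP /forall_inP hP] maxP]] := @ex_maxset _ pr.
  by exists finset.set0; rewrite /pr; apply/andP; split; [apply/finset.trivIsetP=> ?;
    rewrite inE | apply/forall_inP => ?; rewrite inE].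
exists P; split=> // I Ic Iw; rewrite ltnNge; apply/negP => sI.
have [l [lu ls lI]] := card_geqP sI.
pose J := [set:: l]%SET.
have JI : {subset J <= I} by move=> x; rewrite inE => /lI.
have cJ : #|J| = s by rewrite cardsE (card_uniqP lu).
have J0 : J != finset.set0 by rewrite -card_gt0 cJ.
have Jc x : x \in J -> x \notin finset.cover P.
  by move=> /JI /(fintype.subsetP Ic); rewrite inE.
have PJ : J |: P = P.
  apply: maxP (finset.subsetU1 _ _); rewrite /pr; apply/andP; split.
    have dJ Q : Q \in P -> [disjoint J & Q].
      move=> QP; rewrite disjoint_subset; apply/fintype.subsetP => x /Jc.
      by apply: contra => xQ; apply/finset.bigcupP; exists Q.
    apply/finset.trivIsetP => A B;
      rewrite !finset.in_setU1 => /orP[/eqP->|AP] /orP[/eqP->|BP].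
    - by rewrite eqxx.
    - by move=> _; exact: dJ.
    - by move=> _; rewrite disjoint_sym; exact: dJ.
    - by move/finset.trivIsetP: tP; apply.
  apply/forall_inP => Q; rewrite finset.in_setU1 => /orP[/eqP->|/hP //].
  rewrite cJ eqxx andbT; apply/forall_inP => x /JI xI; apply/forall_inP => y /JI yI.
  by move/forall_inP: Iw => /(_ _ xI)/forall_inP/(_ _ yI).
have JP : J \in P by rewrite -PJ finset.setU11.
have /finset.set0Pn[x xJ] := J0.
by move: (Jc x xJ); rewrite (_ : x \in _)//; apply/finset.bigcupP; exists J.
Qed.
Lemma npairs_le (r r' : rel V) (X Y : pred V) :
  (forall x, X x -> Y x) -> (forall x y, r x y -> r' x y) ->
  npairs R r X <= npairs R r' Y.
Proof.
move=> XY rr'; rewrite /npairs [leLHS]big_mkcond [leRHS]big_mkcond.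
apply: ler_sum => x _; case: ifPn => Xx; last first.
  by case: ifPn => // _; apply: sumr_ge0 => y _; exact: ler0n.
rewrite XY// [leLHS]big_mkcond [leRHS]big_mkcond; apply: ler_sum => y _.
case: ifPn => Xy; last by case: ifPn => // _; exact: ler0n.
by rewrite XY// ler_nat; case: (boolP (r x y)) => // /rr' ->.
Qed.

(** If the conclusion failed, both factors in [mantel] would be large. *)
Lemma mantel_few (r : rel V) (X : pred V) (theta : R) :
  symmetric r -> 0 <= theta ->
  ntriangles R r X <= 2 * theta ^+ 2 * m ^+ 3 ->
  npairs R r X <= #|X|%:R ^+ 2 / 2 + theta * m ^+ 2.
Proof.
move=> rs th0 T_le; have := mantel R X rs.
set e := npairs R r X; set T := ntriangles R r X in T_le *.
set n : R := #|X|%:R => mt.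
have n0 : 0 <= n by exact: ler0n.
have nm : n <= m by rewrite ler_nat max_card.
rewrite leNgt; apply/negP => lo.
have n2 := sqr_ge0 n; have m2 : 0 <= theta * m ^+ 2 by rewrite mulr_ge0 ?sqr_ge0.
have : theta * m ^+ 2 * (2 * (theta * m ^+ 2)) < e * (2 * e - n ^+ 2).
  by apply: ltr_pM => //; lra.
have : n * T <= m * (2 * theta ^+ 2 * m ^+ 3).
  have t3 : 0 <= 2 * theta ^+ 2 * m ^+ 3 by rewrite !mulr_ge0 ?sqr_ge0 ?exprn_ge0// ler0n.
  by apply: le_trans (ler_wpM2l n0 T_le) _; exact: ler_wpM2r.
have -> : m * (2 * theta ^+ 2 * m ^+ 3) = theta * m ^+ 2 * (2 * (theta * m ^+ 2)) by ring.
lra.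
Qed.

Lemma npairs_total (X : pred V) (r1 r2 : rel V) :
  (forall x y, x != y -> r1 x y || r2 x y) ->
  #|X|%:R ^+ 2 <= #|X|%:R + npairs R r1 X + npairs R r2 X.
Proof.
move=> h.
have -> : #|X|%:R ^+ 2 = \sum_(x | X x) \sum_(y | X y) 1 :> R.
  by rewrite !sumr_const -[RHS]mulr_natr expr2.
have -> : #|X|%:R = npairs R (fun x y => x == y) X.
  rewrite -sum1_card natr_sum; apply: eq_bigr => x Xx.
  rewrite (bigD1 x)//= eqxx big1 ?addr0// => y /andP[_].
  by rewrite eq_sym => /negbTE ->.
rewrite /npairs -!big_split /=; apply: ler_sum => x _.
rewrite -!big_split /=; apply: ler_sum => y _.
rewrite -!natrD (ler_nat R 1); have [//|/h] := eqVneq x y.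
by case: (r1 x y); case: (r2 x y).
Qed.

Definition nonwhite x y := (x != y) && ~~ w x y.
Definition nonblack x y := (x != y) && ~~ b x y.
Definition white x y := (x != y) && w x y.
Definition black x y := (x != y) && b x y.

Lemma no_white_triangle (N : pred V) :
  ntriangles R white N = 0 -> #|N|%:R ^+ 2 <= 2 * #|N|%:R + 2 * npairs R nonwhite N.
Proof.
move=> T0.
have ws : symmetric white by move=> x y; rewrite /white eq_sym w_sym.
have := @mantel_few white N 0 ws (lexx _).
rewrite T0 expr0n mulr0 mul0r mul0r addr0 => /(_ (lexx _)) h.
have := @npairs_total N white nonwhite.
have c : forall x y, x != y -> white x y || nonwhite x y.
  by move=> x y; rewrite /white /nonwhite => ->; case: (w x y).
move=> /(_ c); lra.
Qed.

Section Split.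
Context (A : {set V}) (nu : R).
Let D := ~: A.
Hypothesis nu0 : 0 < nu.
Hypothesis A_white : npairs R nonwhite (mem A) <= nu ^+ 2 / 4 * m ^+ 2.
Hypothesis m_large : 4 <= nu ^+ 2 * m.

Let C a := [pred d | (d \in D) && ~~ w a d].

(** Three mutually white points of the set in question would make a pattern with
    [x], [y], [z].  A large subset of [A] contains such points by [mantel], as almost
    all pairs in [A] are white. *)
Lemma few_common_neighbours (x y z : V) : x \in D -> y \in D -> z \in D ->
  nonblack x y -> nonblack x z -> nonblack y z ->
  \sum_(a in A) [&& C a x, C a y & C a z]%:R <= nu * m.
Proof.
move=> xD yD zD /andP[xy bxy] /andP[xz bxz] /andP[yz byz].
pose N := [set a in A | [&& C a x, C a y & C a z]]%SET.
have -> : \sum_(a in A) [&& C a x, C a y & C a z]%:R = #|N|%:R :> R.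
  rewrite -sum1_card natr_sum big_mkcond [RHS]big_mkcond; apply: eq_bigr => a _.
  by rewrite /N finset.in_set; case: (a \in A) => //=; case: ifP.
have nm : #|N|%:R <= m by rewrite ler_nat max_card.
have AD a d : a \in A -> d \in D -> a != d.
  by move=> aA; apply: contraTneq => <-; rewrite inE negbK.
have NE t : (mem N : pred V) t -> [/\ t \in A, ~~ w t x, ~~ w t y & ~~ w t z].
  change (t \in N -> [/\ t \in A, ~~ w t x, ~~ w t y & ~~ w t z]).
  by rewrite finset.in_set => /andP[tA /and3P[/andP[_ ?] /andP[_ ?] /andP[_ ?]]].
have T0 : ntriangles R white (mem N) = 0.
  rewrite /ntriangles big1 // => a1 /NE[? ? ? ?].
  rewrite big1 // => a2 /NE[? ? ? ?]; rewrite big1 // => a3 /NE[? ? ? ?].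
  case: (boolP (_ && _)) => // /andP[/andP[/andP[n1 w1] /andP[n2 w2]] /andP[n3 w3]].
  exfalso; move/negP: (free [:: a1; a2; a3] [:: x; y; z]); apply.
  rewrite /K33_pattern /allrel /= !inE !negb_or.
  repeat (apply/andP; split); first [done | exact: AD | exact: w_b].
have := no_white_triangle T0.
have : npairs R nonwhite (mem N) <= npairs R nonwhite (mem A).
  by apply: npairs_le => // t /NE[].
move=> h1 h2.
have m0 : 0 <= m by exact: ler0n.
have h3 : #|N|%:R ^+ 2 <= (nu * m) ^+ 2.
  have hm := ler_wpM2r m0 m_large.
  have -> : (nu * m) ^+ 2 = nu ^+ 2 * m ^+ 2 by ring.
  have hm' : 4 * m <= nu ^+ 2 * m ^+ 2 by rewrite expr2 mulrA.
  move: h2 => /le_trans; apply.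
  have := A_white; lra.
by move: h3; rewrite ler_sqr ?nnegrE ?mulr_ge0 ?ler0n ?(ltW nu0).
Qed.

Lemma sum_nonblack_triangles :
  \sum_(a in A) ntriangles R nonblack (C a) <= nu * m ^+ 4.
Proof.
have -> : \sum_(a in A) ntriangles R nonblack (C a) =
  \sum_(x in D) \sum_(y in D) \sum_(z in D)
   ([&& nonblack x y, nonblack x z & nonblack y z]%:R *
    \sum_(a in A) [&& C a x, C a y & C a z]%:R).
  have cvt a (F : V -> R) : \sum_(x | C a x) F x = \sum_(x in D) (C a x)%:R * F x.
    rewrite big_mkcond [RHS]big_mkcond; apply: eq_bigr => x _ /=.
    by case: (x \in D) => //=; case: (w a x); rewrite ?mul0r ?mul1r.
  transitivity (\sum_(a in A) \sum_(x in D) \sum_(y in D) \sum_(z in D)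
    [&& nonblack x y, nonblack x z & nonblack y z]%:R * [&& C a x, C a y & C a z]%:R : R).
    apply: eq_bigr => a _; rewrite /ntriangles cvt; apply: eq_bigr => x _.
    rewrite cvt mulr_sumr; apply: eq_bigr => y _.
    rewrite cvt !mulr_sumr; apply: eq_bigr => z _.
    move: (nonblack x y) (nonblack x z) (nonblack y z) (C a x) (C a y) (C a z).
    by move=> [] [] [] [] [] [] /=; rewrite ?(mulr0, mul0r, mulr1).
  rewrite exchange_big; apply: eq_bigr => x _.
  rewrite exchange_big; apply: eq_bigr => y _.
  rewrite exchange_big; apply: eq_bigr => z _.
  by rewrite mulr_sumr.
have m0 : 0 <= m by exact: ler0n.
have nm0 : 0 <= nu * m by rewrite mulr_ge0 ?(ltW nu0).
have Dm (r : R) : 0 <= r -> \sum_(x in D) r <= m * r.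
  by move=> r0; rewrite sumr_const -mulr_natl ler_wpM2r// ler_nat max_card.
have -> : nu * m ^+ 4 = m * (m * (m * (nu * m))) by ring.
apply: le_trans (Dm _ (mulr_ge0 m0 (mulr_ge0 m0 nm0))).
apply: ler_sum => x xD; apply: le_trans (Dm _ (mulr_ge0 m0 nm0)).
apply: ler_sum => y yD; apply: le_trans (Dm _ nm0).
apply: ler_sum => z zD.
case: (boolP (_ && _)) => [/and3P[h1 h2 h3]|_]; last by rewrite mul0r.
by rewrite mul1r; exact: few_common_neighbours.
Qed.

(** When few nonblack triangles lie in [C a], [mantel_few] makes about half of the
    pairs in [C a] black.  For the other [a] the trivial bound [#|C a| <= m] suffices,
    because there the number of triangles divided by [2 * theta ^+ 2 * m] exceeds
    [m ^+ 2]; one inequality thus covers all [a] and can be summed. *)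
Lemma black_pairs_ge (theta : R) : 0 < theta -> nu = 2 * theta ^+ 3 ->
  (\sum_(a in A) #|C a|%:R) ^+ 2 / 2 <=
  #|A|%:R * (#|A|%:R * (npairs R black (mem D) + m + theta * m ^+ 2) + theta * m ^+ 3).
Proof.
move=> th0 nuE; have m0 : 0 <= m by exact: ler0n.
have mp : 0 < m by rewrite lt_def m0 andbT; apply/eqP => m00; move: m_large;
  rewrite m00 mulr0; lra.
set NB := npairs R black _.
have NB0 : 0 <= NB by apply: sumr_ge0 => x _; apply: sumr_ge0 => y _; exact: ler0n.
have key a : a \in A -> #|C a|%:R ^+ 2 / 2 <=
    NB + m + theta * m ^+ 2 + ntriangles R nonblack (C a) / (2 * theta ^+ 2 * m).
  move=> aA; set T := ntriangles _ _ _; set n : R := #|C a|%:R.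
  have n0 : 0 <= n by exact: ler0n.
  have nm : n <= m by rewrite ler_nat max_card.
  have d0 : 0 < 2 * theta ^+ 2 * m by rewrite !mulr_gt0// exprn_gt0.
  have T0 : 0 <= T by do 3!(apply: sumr_ge0 => ? _); exact: ler0n.
  have [Tle|Tgt] := leP T (2 * theta ^+ 2 * m ^+ 3).
    have nbs : symmetric nonblack by move=> x y; rewrite /nonblack eq_sym b_sym.
    have h1 := mantel_few nbs (ltW th0) Tle; rewrite -/n in h1.
    have h2 : n ^+ 2 <= n + npairs R black (C a) + npairs R nonblack (C a).
      apply: npairs_total => x y; rewrite /black /nonblack => ->.
      by case: (b x y).
    have h3 : npairs R black (C a) <= NB.
      by apply: npairs_le => // x /andP[].
    have h4 : 0 <= T / (2 * theta ^+ 2 * m) by rewrite divr_ge0// ltW.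
    lra.
  have h1 : m ^+ 2 <= T / (2 * theta ^+ 2 * m).
    by rewrite ler_pdivlMr//; apply: le_trans (ltW Tgt); le_by_ring.
  have h2 : n ^+ 2 <= m ^+ 2 by rewrite lerXn2r.
  have h3 : 0 <= theta * m ^+ 2 by rewrite mulr_ge0 ?sqr_ge0 ?ltW.
  have := sqr_ge0 m; lra.
have cs := sqr_sum_le (mem A) (fun a => #|C a|%:R : R).
have A0 : 0 <= (#|A|%:R : R) by exact: ler0n.
have /le_trans : (\sum_(a in A) #|C a|%:R) ^+ 2 / 2 <=
   #|A|%:R * (\sum_(a in A) #|C a|%:R ^+ 2 / 2 : R).
  by rewrite -mulr_suml mulrA ler_wpM2r// invr_ge0.
apply; rewrite ler_wpM2l//.
apply: le_trans (ler_sum _ key) _; rewrite big_split /= sumr_const.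
rewrite -[_ *+ #|A|]mulr_natl lerD2l -mulr_suml ler_pdivrMr;
  last by rewrite !mulr_gt0// exprn_gt0.
apply: le_trans sum_nonblack_triangles _;
  rewrite nuE le_eqVlt; apply/orP; left; apply/eqP; ring.
Qed.

End Split.

(** The first part [A] is the union of a maximal packing of white [s]-cliques.  The
    hypotheses on [s] and [m] are those of the Kovari-Sos-Turan step, of the gray
    triangle count, of the passage to large subsets of [A], and of absorbing linear
    terms in the error. *)
Lemma three_colour_cost_ge (p theta : R) (s : nat) :
  0 < p -> p ^+ 2 + 2 * p = 1 -> 0 < theta -> theta <= 1 ->
  5 <= ((2 * theta ^+ 3) ^+ 2 / 4) ^+ 3 * s%:R ->
  3 * s%:R ^+ 7 <= (2 * theta ^+ 2) ^+ 8 * m ->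
  4 <= (2 * theta ^+ 3) ^+ 2 * m -> 1 <= theta * m ->
  p ^+ 2 * m ^+ 2 - 26 * theta * m ^+ 2 <=
  p * npairs R white predT + (1 - p) * npairs R black predT.
Proof.
move=> p0 pE th0 th1 hs hm1 hm2 hm3.
have m0 : 0 <= m by exact: ler0n.
have mp : 0 < m by nra.
have s_gt0 : (0 < s)%N by case: (s) hs => //; rewrite mulr0; lra.
have [P [tP hP hD]] := white_clique_packing s_gt0.
set A := finset.cover P in hD.
have eta0 : 0 < (2 * theta ^+ 3) ^+ 2 / 4 by rewrite !(mulr_gt0, exprn_gt0).
have NWA := nonwhite_in_cover tP hP eta0 hs; rewrite -/A in NWA.
pose D := (~: A)%SET.
pose alpha : R := #|A|%:R; pose delta : R := #|D|%:R.
have am : alpha <= m by rewrite ler_nat max_card.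
have a0 : 0 <= alpha by exact: ler0n.
have d0 : 0 <= delta by exact: ler0n.
have adm : alpha + delta = m by rewrite /alpha /delta -natrD cardsC.
have eta_th : (2 * theta ^+ 3) ^+ 2 / 4 <= theta.
  have -> : (2 * theta ^+ 3) ^+ 2 / 4 = theta * theta ^+ 5 by field.
  by rewrite ler_piMr ?(ltW th0)// exprn_ile1// ltW.
have m2 : m <= theta * m ^+ 2 by rewrite expr2 mulrA ler_peMl.
have NWA1 : npairs R nonwhite (mem A) <= (2 * theta ^+ 3) ^+ 2 / 4 * m ^+ 2.
  by apply: le_trans NWA _; rewrite ler_wpM2l ?(ltW eta0)// lerXn2r.
have NWA2 : npairs R nonwhite (mem A) <= theta * m ^+ 2.
  by apply: le_trans NWA1 _; rewrite ler_wpM2r// sqr_ge0.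
have WAA := @npairs_total (mem A) white nonwhite.
have {}WAA := WAA (ltac:(by move=> x y; rewrite /white /nonwhite => ->; case: (w x y))).
rewrite -/alpha in WAA.
have Dcl (I : {set V}) : I \subset D -> white_clique I -> (#|I| <= s)%N.
  by move=> ID Iw; apply: ltnW; exact: hD.
have Tg := gray_triangles_few Dcl.
have {Tg} Tg : ntriangles R gray (mem D) <= 2 * theta ^+ 2 * m ^+ 3.
  have t0 : 0 <= 2 * theta ^+ 2 * m ^+ 3 by rewrite !mulr_ge0 ?exprn_ge0 ?ltW.
  have T0 : 0 <= ntriangles R gray (mem D) by do 3!(apply: sumr_ge0 => ? _); exact: ler0n.
  rewrite -(@ler_pXn2r _ 8)// ?nnegrE//; apply: le_trans Tg _.
  have := ler_wpM2r (exprn_ge0 23 m0) hm1 => /le_trans; apply.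
  by le_by_ring.
have eg := mantel_few gray_sym (ltW th0) Tg; rewrite -/delta in eg.
have WDD := @npairs_total (mem D) white (fun x y => black x y || gray x y).
have {}WDD := WDD (ltac:(by move=> x y; rewrite /white /black /gray => ->; case: (w x y);
  case: (b x y))).
rewrite -/delta in WDD.
set NB := npairs R black (mem D).
have NB0 : 0 <= NB by do 2!(apply: sumr_ge0 => ? _); exact: ler0n.
have bg : npairs R (fun x y => black x y || gray x y) (mem D) <= NB + npairs R gray (mem D).
  rewrite /NB /npairs -big_split; apply: ler_sum => x _.
  rewrite -big_split; apply: ler_sum => y _ /=.
  by rewrite -natrD ler_nat; case: (black x y); case: (gray x y).
pose C a := [pred d | (d \in D) && ~~ w a d].
pose S : R := \sum_(a in A) #|C a|%:R.
have bl := black_pairs_ge (mulr_gt0 (ltr0Sn _ 1) (exprn_gt0 3 th0)) NWA1 hm2 th0 erefl.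
rewrite -/D -/NB -/alpha -/S in bl.
have S0 : 0 <= S by apply: sumr_ge0 => ? _; exact: ler0n.
have Sad : S <= alpha * delta.
  rewrite /S /alpha mulr_natl -sumr_const; apply: ler_sum => a _.
  by rewrite ler_nat subset_leq_card//; apply/fintype.subsetP => x /andP[].
have WAD : \sum_(x in A) \sum_(y in D) (white x y)%:R = alpha * delta - S.
  rewrite /S /alpha mulr_natl -sumr_const -sumrB; apply: eq_bigr => a aA.
  rewrite /delta -!sum1_card !natr_sum [\sum_(y in C a) _]big_mkcond [\sum_(y in D)
    _]big_mkcond.
  rewrite [X in _ = X - _]big_mkcond -sumrB; apply: eq_bigr => y _.
  rewrite [y \in C a]inE; case: ifPn => yD /=; last by rewrite subr0.
  have ay : a != y by apply: contraTneq yD => <-; rewrite inE aA.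
  by rewrite /white ay; case: (w a y); rewrite /= ?subr0 ?subrr.
have W : npairs R white predT =
  npairs R white (mem A) + 2 * (alpha * delta - S) + npairs R white (mem D).
  have sp (F : V -> R) : \sum_x F x = \sum_(x in A) F x + \sum_(x in D) F x.
    by rewrite (bigID (mem A)) /=; congr (_ + _); apply: eq_bigl => x; rewrite inE.
  rewrite /npairs sp.
  under eq_bigr => x _ do rewrite sp.
  under [X in _ + X = _]eq_bigr => x _ do rewrite sp.
  rewrite !big_split /= WAD.
  have -> : \sum_(x in D) \sum_(y in A) (white x y)%:R = alpha * delta - S.
    rewrite exchange_big -WAD; apply: eq_bigr => x _; apply: eq_bigr => y _.
    by rewrite /white eq_sym w_sym.
  by rewrite -[RHS]addrA; ring.
have Bk : NB <= npairs R black predT by exact: npairs_le.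
have Wlo : alpha ^+ 2 + 2 * (alpha * delta - S) + delta ^+ 2 / 2 - NB -
    5 * (theta * m ^+ 2) <= npairs R white predT.
  rewrite W; lra.
have t0 : 0 <= theta * m ^+ 2 by lra.
have := split_cost p0 pE a0 d0 t0 S0 Sad NB0 Bk Wlo.
rewrite adm -[26 * theta * _]mulrA; apply; apply: le_trans bl _.
rewrite ler_wpM2l// (_ : theta * m ^+ 3 = theta * m ^+ 2 * m); last by ring.
by rewrite lerD2r ler_wpM2l//; lra.
Qed.
End ThreeColour.
(** * Weak regularity *)

Section ConditionalAverage.
Context (R : realFieldType) (X : finType).

Definition block_avg (L : finType) (l : X -> L) (f : X -> R) (a : L) : R :=
  (\sum_(y | l y == a) f y) / #|[pred y | l y == a]|%:R.

Definition cond_avg (L : finType) (l : X -> L) (f : X -> R) (x : X) : R :=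
  block_avg l f (l x).

Lemma block_gt0 (L : finType) (l : X -> L) (x : X) :
  0 < #|[pred y | l y == l x]|%:R :> R.
Proof. by rewrite ltr0n; apply/card_gt0P; exists x; rewrite inE. Qed.

Lemma cond_avgE (L : finType) (l : X -> L) (f : X -> R) (h : L -> R) :
  \sum_x cond_avg l f x * h (l x) = \sum_x f x * h (l x).
Proof.
rewrite (partition_big l predT)//= [RHS](partition_big l predT)//=.
apply: eq_bigr => a _.
rewrite (eq_bigr (fun=> block_avg l f a * h a)); last first.
  by move=> x /eqP <-.
rewrite [RHS](eq_bigr (fun x => f x * h a)); last by move=> x /eqP <-.
rewrite -[LHS]mulr_suml -[RHS]mulr_suml; congr (_ * _).
rewrite sumr_const -[LHS]mulr_natl.
have [a0|a0] := eqVneq (#|[pred y | l y == a]|%:R : R) 0; last first.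
  by rewrite /block_avg mulrC divfK.
rewrite a0 mul0r big1// => x /eqP xa.
by have := block_gt0 l x; rewrite xa a0 ltxx.
Qed.

Lemma cond_avg_bound (L : finType) (l : X -> L) (f : X -> R) :
  (forall x, 0 <= f x <= 1) -> forall x, 0 <= cond_avg l f x <= 1.
Proof.
move=> f01 x; rewrite /cond_avg /block_avg; have n0 := block_gt0 l x.
rewrite divr_ge0 ?(ltW n0)//=; last by apply: sumr_ge0 => y _; case/andP: (f01 y).
rewrite ler_pdivrMr// mul1r -sum1_card natr_sum; apply: ler_sum => y _.
by case/andP: (f01 y).
Qed.

(** [cond_avg l f] is the orthogonal projection of [f] to the functions of [l], and
    functions of [l] are functions of the finer [l']. *)
Lemma cond_avg_pythagoras (L L' : finType) (l : X -> L) (l' : X -> L')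
    (r : L' -> L) (f : X -> R) :
  (forall x, l x = r (l' x)) ->
  \sum_x (cond_avg l' f x - cond_avg l f x) ^+ 2 =
  \sum_x cond_avg l' f x ^+ 2 - \sum_x cond_avg l f x ^+ 2.
Proof.
move=> lr.
have cross : \sum_x cond_avg l' f x * cond_avg l f x = \sum_x cond_avg l f x ^+ 2.
  rewrite -[RHS]/(\sum_x cond_avg l f x * block_avg l f (l x)) cond_avgE.
  rewrite -(eq_bigr _ (fun x _ => congr1 (fun a => f x * block_avg l f a) (esym (lr x)))).
  rewrite -(cond_avgE l' f (fun a => block_avg l f (r a))).
  by apply: eq_bigr => x _; rewrite /cond_avg lr.
rewrite (eq_bigr (fun x => cond_avg l' f x ^+ 2 - 2 * (cond_avg l' f x * cond_avg l f x)
   + cond_avg l f x ^+ 2)); last by move=> x _; ring.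
by rewrite big_split sumrB -mulr_sumr /= cross; ring.
Qed.

End ConditionalAverage.

Section WeakRegularity.
Context (R : realType).

(** Closeness in the cut norm of Frieze and Kannan, scaled by the number of pairs. *)
Definition cut_close (V : finType) (eps : R) (f g : V * V -> R) :=
  forall S T : pred V,
    `|\sum_(x : V * V | S x.1 && T x.2) (f x - g x)| <= eps * #|V|%:R ^+ 2.

Definition pair_label (V L : finType) (l : V -> L) (x : V * V) : L * L :=
  (l x.1, l x.2).

Definition step_fun (V L : finType) (l : V -> L) (f : V * V -> R) :=
  cond_avg (pair_label l) f.

Definition energy (V L : finType) (l : V -> L) (f : V * V -> R) : R :=
  \sum_x step_fun l f x ^+ 2.

Lemma energy_le (V L : finType) (l : V -> L) (f : V * V -> R) :
  (forall x, 0 <= f x <= 1) -> energy l f <= #|V|%:R ^+ 2.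
Proof.
move=> f01; have -> : #|V|%:R ^+ 2 = \sum_(x : V * V) 1 :> R.
  by rewrite sumr_const card_prod natrM expr2.
apply: ler_sum => x _; have /andP[h0 h1] := cond_avg_bound (pair_label l) f01 x.
by rewrite exprn_ile1.
Qed.

(** Sets [S] and [T] witnessing the failure are made part of the label.  The new step
    function has the same sum as [f] over [S * T], so it is far from the old one in
    mean square, and by Pythagoras this distance is the gain in energy. *)
Lemma energy_increment (V L : finType) (l : V -> L) (f : V * V -> R) (eps : R) :
  (0 < #|V|)%N -> 0 < eps -> ~ cut_close eps f (step_fun l f) ->
  exists l' : V -> L * bool * bool,
    energy l f + eps ^+ 2 * #|V|%:R ^+ 2 <= energy l' f.
Proof.
move=> V0 eps0 /existsNP[S /existsNP[T /negP]]; rewrite -ltNge => far.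
pose l' v := (l v, S v, T v); exists l'.
set n : R := #|V|%:R in far *; have n0 : 0 < n by rewrite ltr0n.
have := @cond_avg_pythagoras R _ _ _ (pair_label l) (pair_label l')
  (fun a => (a.1.1.1, a.2.1.1)) f (fun x => erefl).
rewrite -/(energy l f) -/(energy l' f) -/(step_fun l f) -/(step_fun l' f) => py.
have ind : \sum_(x : V * V | S x.1 && T x.2) (f x - step_fun l f x) =
    \sum_(x : V * V | S x.1 && T x.2) (step_fun l' f x - step_fun l f x).
  rewrite !sumrB; congr (_ - _).
  pose h (a : (L * bool * bool) * (L * bool * bool)) : R := (a.1.1.2 && a.2.2)%:R.
  have := cond_avgE (pair_label l') f h; rewrite -/(step_fun l' f) /h /= => e.
  have cv (F : V * V -> R) : \sum_(x :
    V * V | S x.1 && T x.2) F x = \sum_x F x * (S x.1 && T x.2)%:R.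
    rewrite big_mkcond; apply: eq_bigr => x _.
    by case: (S x.1 && T x.2); rewrite ?mulr1 ?mulr0.
  by rewrite !cv.
rewrite ind in far.
have cs := sqr_sum_le [pred x : V *
  V | S x.1 && T x.2] (fun x => step_fun l' f x - step_fun l f x).
have c1 : \sum_(x | [pred x : V *
  V | S x.1 && T x.2] x) (step_fun l' f x - step_fun l f x) ^+ 2
  <= \sum_x (step_fun l' f x - step_fun l f x) ^+ 2.
  rewrite [leLHS]big_mkcond; apply: ler_sum => x _.
  by case: ifP => // _; exact: sqr_ge0.
have c2 : #|[pred x : V * V | S x.1 && T x.2]|%:R <= n ^+ 2.
  by rewrite /n -natrX ler_nat (leq_trans (max_card _))// card_prod.
have c0 : 0 <= \sum_(x | [pred x : V *
  V | S x.1 && T x.2] x) (step_fun l' f x - step_fun l f x) ^+ 2.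
  by apply: sumr_ge0 => x _; exact: sqr_ge0.
have c3 := ler_pM (ler0n _ _) c0 c2 c1.
have c4 := le_trans cs c3; rewrite /= py in c4.
have c5 : (eps * n ^+ 2) ^+ 2 <= n ^+ 2 * (energy l' f - energy l f).
  apply: le_trans c4; rewrite -[leRHS]real_normK ?num_real//.
  rewrite lerXn2r ?nnegrE ?normr_ge0 ?mulr_ge0 ?exprn_ge0 ?ltW//.
have n2 : 0 < n ^+ 2 by rewrite exprn_gt0.
rewrite -(ler_pM2l n2); lra.
Qed.

(** The energy never exceeds [#|V| ^ 2], so less than [eps ^- 2] refinements are
    needed, each of which multiplies the number of labels by four. *)
Lemma weak_regularity (eps : R) : 0 < eps -> exists K : nat,
  forall (V : finType) (f : V * V -> R), (0 < #|V|)%N -> (forall x, 0 <= f x <= 1) ->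
  exists (L : finType) (l : V -> L), (#|L| <= K)%N /\ cut_close eps f (step_fun l f).
Proof.
move=> eps0; pose k := Num.Def.archi_bound (eps ^- 2); exists (4 ^ k)%N.
move=> V f V0 f01.
have n0 : 0 < #|V|%:R :> R by rewrite ltr0n.
have iter j : (exists (L : finType) (l :
  V -> L), (#|L| <= 4 ^ j)%N /\ cut_close eps f (step_fun l f)) \/
    (exists (L : finType) (l : V -> L), (#|L| <= 4 ^ j)%N /\
       j%:R * (eps ^+ 2 * #|V|%:R ^+ 2) <= energy l f).
  elim: j => [|j [[L [l [cL cc]]]|[L [l [cL en]]]]].
  - right; exists unit, (fun=> tt); rewrite card_unit; split=> //.
    by rewrite mul0r; apply: sumr_ge0 => x _; exact: sqr_ge0.
  - left; exists L, l; split=> //; apply: leq_trans cL _.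
    by rewrite leq_exp2l.
  have [cc|ncc] := pselect (cut_close eps f (step_fun l f)).
    by left; exists L, l; split=> //; apply: leq_trans cL _; rewrite leq_exp2l.
  have [l' hl'] := energy_increment V0 eps0 ncc.
  right; exists (L * bool * bool)%type, l'; split.
    by rewrite !card_prod card_bool -mulnA expnSr leq_mul2r cL orbT.
  by rewrite -natr1 mulrDl mul1r; apply: le_trans hl'; rewrite lerD2r.
have [//|[L [l [_ en]]]] := iter k.
have := le_trans en (energy_le l f01).
have n2 : 0 < #|V|%:R ^+ 2 :> R by rewrite exprn_gt0.
rewrite mulrA ger_pMl// => le1; exfalso.
have e2 : 0 < eps ^+ 2 by rewrite exprn_gt0.
have e2i : 0 <= eps ^- 2 by rewrite invr_ge0 ltW.
have := archi_boundP e2i; rewrite -/k.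
by rewrite -(ltr_pM2r e2) mulVf ?gt_eqF// ltNge le1.
Qed.
End WeakRegularity.
(** * The counting lemma *)

Lemma sum_pairE (R : nmodType) (V : finType) (F : V * V -> R) :
  \sum_x F x = \sum_u \sum_v F (u, v).
Proof. by rewrite pair_bigA; apply: eq_bigr => -[u v]. Qed.

Section CutCloseFunctions.
Context (R : realType) (V : finType).

(** The left-hand side is linear in [a] and in [b], hence largest for weights in
    {0, 1}. *)
Lemma sum_weights_le (c : R) (h : V * V -> R) (a b : V -> R) :
  (forall S T : pred V, \sum_(x : V * V | S x.1 && T x.2) h x <= c) ->
  (forall v, 0 <= a v <= 1) -> (forall v, 0 <= b v <= 1) ->
  \sum_x h x * (a x.1 * b x.2) <= c.
Proof.
move=> hc a01 b01.
have pos_part (k e : V -> R) : (forall v, 0 <= e v <= 1) ->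
    \sum_v k v * e v <= \sum_(v | 0 < k v) k v.
  move=> e01; rewrite [leRHS]big_mkcond; apply: ler_sum => v _.
  have /andP[e0 e1] := e01 v; case: ltP => [k0|k0].
    by rewrite ler_piMr// ltW.
  by rewrite mulr_le0_ge0.
pose k u := \sum_v h (u, v) * b v.
have -> : \sum_x h x * (a x.1 * b x.2) = \sum_u k u * a u.
  rewrite sum_pairE; apply: eq_bigr => u _; rewrite mulr_suml.
  by apply: eq_bigr => v _ /=; rewrite mulrAC mulrA.
apply: le_trans (pos_part k a a01) _.
pose k2 v := \sum_(u | 0 < k u) h (u, v).
have -> : \sum_(u | 0 < k u) k u = \sum_v k2 v * b v.
  by rewrite exchange_big; apply: eq_bigr => v _; rewrite mulr_suml.
apply: le_trans (pos_part k2 b b01) _.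
rewrite exchange_big pair_big /=.
apply: le_trans (hc (fun u => 0 < k u) (fun v => 0 < k2 v)).
by rewrite le_eqVlt; apply/orP; left; apply/eqP; apply: eq_bigr => -[u v].
Qed.

Lemma cut_close_weights (eps : R) (f g : V * V -> R) (a b : V -> R) :
  cut_close eps f g ->
  (forall v, 0 <= a v <= 1) -> (forall v, 0 <= b v <= 1) ->
  `|\sum_x (f x - g x) * (a x.1 * b x.2)| <= eps * #|V|%:R ^+ 2.
Proof.
move=> fg a01 b01; rewrite ler_norml lerNl -sumrN; apply/andP; split.
  have := @sum_weights_le (eps * #|V|%:R ^+ 2) (fun x => - (f x - g x)) a b.
  under eq_bigr => x _ do rewrite mulNr.
  apply=> // S T; rewrite sumrN.
  by have := fg S T; rewrite ler_norml lerNl => /andP[].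
apply: sum_weights_le => // S T.
by have := fg S T; rewrite ler_norml => /andP[].
Qed.

End CutCloseFunctions.

Section Update.
Context (R : realType) (S V : finType).
Implicit Types (x : {ffun S -> V}) (i j s : S) (u v : V).

Definition upd x i u : {ffun S -> V} := [ffun s => if s == i then u else x s].

Lemma upd_same x i u : upd x i u i = u.
Proof. by rewrite ffunE eqxx. Qed.

Lemma upd_other x i u s : s != i -> upd x i u s = x s.
Proof. by rewrite ffunE => /negbTE ->. Qed.

(** Exchanging [u] with the value of [x] at [i] is an involution. *)
Lemma sum_upd i (F : {ffun S -> V} -> R) :
  \sum_x \sum_u F (upd x i u) = #|V|%:R * \sum_x F x.
Proof.
pose T (p : {ffun S -> V} * V) := (upd p.1 i p.2, p.1 i).
have Tinj : involutive T.
  move=> [x u]; rewrite /T /= upd_same; congr (_, _).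
  by apply/ffunP => s; rewrite !ffunE; case: eqP => // ->.
rewrite (pair_bigA _ (fun x u => F (upd x i u))) /=.
transitivity (\sum_(p : {ffun S -> V} * V) F p.1).
  by rewrite [RHS](reindex_inj (inv_inj Tinj)).
rewrite -(pair_bigA _ (fun x (u : V) => F x)) /= mulr_sumr.
by apply: eq_bigr => x _; rewrite sumr_const mulr_natl.
Qed.

Definition upd2 x i j u v := upd (upd x i u) j v.

Lemma sum_upd2 i j (F : {ffun S -> V} -> R) :
  \sum_x \sum_u \sum_v F (upd2 x i j u v) = #|V|%:R ^+ 2 * \sum_x F x.
Proof.
rewrite (sum_upd i (fun y => \sum_v F (upd y j v))) sum_upd.
by rewrite mulrA expr2.
Qed.

End Update.

Definition hom_weight (R : realType) (S V : finType) (E : pred (S * S))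
    (W : S * S -> V * V -> R) (x : {ffun S -> V}) : R :=
  \prod_(e | E e) W e (x e.1, x e.2).

Section Counting.
Context (R : realType) (S V : finType).
Variable E : pred (S * S).
Hypothesis E_neq : forall e, E e -> e.1 != e.2.
Hypothesis E_anti : forall s t, E (s, t) -> ~~ E (t, s).

(** Resample [x i] and [x j] for [e0 = (i, j)] with the other coordinates fixed.  Every
    remaining factor involves at most one of [i] and [j], so their product has the form
    [a u * b v], and closeness in the cut norm applies. *)
Lemma swap_one (eps : R) (f g : V * V -> R) (W : S * S -> V * V -> R) (e0 : S * S) :
  cut_close eps f g -> (forall e p, 0 <= W e p <= 1) -> E e0 -> (0 < #|V|)%N ->
  `|\sum_(x : {ffun S -> V}) (f (x e0.1, x e0.2) - g (x e0.1, x e0.2)) *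
      \prod_(e | E e && (e != e0)) W e (x e.1, x e.2)| <=
  eps * #|{ffun S -> V}|%:R.
Proof.
case: e0 => i j /= fg W01 Eij V0; have ij := E_neq Eij; rewrite /= in ij.
pose F (x : {ffun S -> V}) := (f (x i, x j) - g (x i, x j)) *
  \prod_(e | E e && (e != (i, j))) W e (x e.1, x e.2).
rewrite -[X in `|X|]/(\sum_x F x).
have n2 : 0 < #|V|%:R ^+ 2 :> R by rewrite exprn_gt0// ltr0n.
have nE : #|V|%:R ^+ 2 * `|\sum_x F x| = `|\sum_x \sum_u \sum_v F (upd2 x i j u v)|.
  by rewrite sum_upd2 normrM (gtr0_norm n2).
rewrite -(ler_pM2l n2) nE.
have prod01 (P : pred (S * S)) (y : {ffun S -> V}) :
    0 <= \prod_(e | P e) W e (y e.1, y e.2) <= 1.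
  rewrite prodr_ge0 /=; last by move=> e _; case/andP: (W01 e (y e.1, y e.2)).
  by apply: prodr_ile1 => e _; exact: W01.
have inner x : `|\sum_u \sum_v F (upd2 x i j u v)| <= eps * #|V|%:R ^+ 2.
  pose tj (e : S * S) := (e.1 == j) || (e.2 == j).
  pose a u := \prod_(e | (E e && (e != (i, j))) && ~~ tj e)
                W e (upd x i u e.1, upd x i u e.2).
  pose b v := \prod_(e | (E e && (e != (i, j))) && tj e)
                W e (upd x j v e.1, upd x j v e.2).
  have FE u v : F (upd2 x i j u v) = (f (u, v) - g (u, v)) * (a u * b v).
    rewrite /F (_ : upd2 x i j u v i = u); last by rewrite upd_other// upd_same.
    rewrite upd_same; congr (_ * _); rewrite (bigID tj) /= mulrC; congr (_ * _).
      apply: eq_bigr => e /andP[_]; rewrite negb_or => /andP[e1 e2].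
      by rewrite !(upd_other _ _ e1) !(upd_other _ _ e2).
    apply: eq_bigr => -[s t] /andP[/andP[Est st]] jst.
    have ni z : z != i -> upd2 x i j u v z = upd x j v z.
      by move=> zi; rewrite !ffunE (negbTE zi).
    suff /andP[si ti] : (s != i) && (t != i) by rewrite /= !ni.
    move: jst (E_neq Est); rewrite /tj /= => /orP[]/eqP ?; subst.
      rewrite eq_sym in ij; rewrite ij /= => _; apply: contraTneq Est => ->.
      exact: E_anti.
    move=> sj; rewrite eq_sym in ij; rewrite ij andbT.
    by apply: contraNneq st => ->.
  under eq_bigr => u _ do under eq_bigr => v _ do rewrite FE.
  rewrite -(sum_pairE (fun p => (f p - g p) * (a p.1 * b p.2))).
  apply: (cut_close_weights fg) =>
    v; [exact: (prod01 _ (upd x i v)) | exact: (prod01 _ (upd x j v))].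
apply: le_trans (ler_norm_sum _ _ _) _.
apply: le_trans (ler_sum _ (fun x _ => inner x)) _.
by rewrite sumr_const -[leLHS]mulr_natl mulrCA [#|_|%:R * _]mulrC mulrCA.
Qed.

(** Replace the factors one at a time; [swap_one] bounds each replacement. *)
Lemma counting_lemma (eps : R) (f g : S * S -> V * V -> R) :
  (forall e, cut_close eps (f e) (g e)) ->
  (forall e p, 0 <= f e p <= 1) -> (forall e p, 0 <= g e p <= 1) -> (0 < #|V|)%N ->
  `|\sum_x hom_weight E f x - \sum_x hom_weight E g x| <=
  #|E|%:R * eps * #|{ffun S -> V}|%:R.
Proof.
move=> fg f01 g01 V0.
pose mix (js : seq (S * S)) e := if e \in js then g e else f e.
have step js : uniq js -> all E js ->
    `|\sum_x hom_weight E f x - \sum_x hom_weight E (mix js) x| <=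
    (size js)%:R * eps * #|{ffun S -> V}|%:R.
  elim: js => [|e0 js IH] /=; first by rewrite subrr normr0 !mul0r.
  move=> /andP[e0js ujs] /andP[Ee0 Ejs].
  have mix01 e p : 0 <= mix js e p <= 1 by rewrite /mix; case: ifP.
  have := swap_one (fg e0) mix01 Ee0 V0.
  have -> : \sum_(x : {ffun S -> V}) (f e0 (x e0.1, x e0.2) - g e0 (x e0.1, x e0.2)) *
      \prod_(e | E e && (e != e0)) mix js e (x e.1, x e.2) =
      \sum_x hom_weight E (mix js) x - \sum_x hom_weight E (mix (e0 :: js)) x.
    rewrite -sumrB; apply: eq_bigr => x _; rewrite /hom_weight.
    rewrite [X in _ = X - _](bigD1 e0 Ee0) [X in _ = _ - X](bigD1 e0 Ee0) /=.
    rewrite /mix inE eqxx (negbTE e0js).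
    rewrite mulrBl; congr (_ - _ * _); apply: eq_bigr => e /andP[_ ee0].
    by rewrite inE (negbTE ee0).
  move=> h; rewrite -natr1 mulrDl mul1r mulrDl.
  have := IH ujs Ejs; set A := \sum_x _; set B := \sum_x _ in h *.
  set C := \sum_x _ in h * => h2.
  have -> : A - C = (A - B) + (B - C) by ring.
  by apply: le_trans (ler_normD _ _) _; rewrite lerD.
have := step (enum E) (enum_uniq _) _; rewrite -cardE.
have -> : \sum_x hom_weight E (mix (enum E)) x = \sum_x hom_weight E g x.
  apply: eq_bigr => x _; apply: eq_bigr => e Ee.
  by rewrite /mix mem_enum -topredE /= Ee.
by apply; apply/allP => e; rewrite mem_enum.
Qed.

End Counting.
(** * Patterns, samples and the cost of editing *)

Lemma adjC (T : finType) (G : sgraph T) : symmetric (adj G).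
Proof. by move=> x y; rewrite /adj finset.setUC. Qed.

Lemma adjxx (T : finType) (G : sgraph T) x : adj G x x = false.
Proof.
apply/negP; rewrite /adj; case: G => E /= /forall_inP HE /HE.
by rewrite finset.setUid cards1.
Qed.

(** A place where the colours permit an induced copy of [H]; see [K33_pattern]. *)
Definition blowup_pattern (S V : finType) (H : sgraph S) (w b : rel V)
    (x : {ffun S -> V}) :=
  [forall s, forall t, (s != t) ==>
     if adj H s t then ~~ w (x s) (x t) else ~~ b (x s) (x t)].

Section PatternCount.
Context (R : realType) (S V : finType) (H : sgraph S).

(** Selects one orientation of each pair of vertices of [H]. *)
Definition increasing (e : S * S) := (enum_rank e.1 < enum_rank e.2)%N.

Lemma increasing_neq e : increasing e -> e.1 != e.2.
Proof. by case: e => s t; apply: contraTneq => /= ->; rewrite /increasing ltnn. Qed.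

Lemma increasing_anti s t : increasing (s, t) -> ~~ increasing (t, s).
Proof. by rewrite /increasing -leqNgt => /ltnW. Qed.

Definition induced_factor (f : V * V -> R) (e : S * S) (p : V * V) : R :=
  if adj H e.1 e.2 then f p else 1 - f p.

Lemma induced_factor01 f : (forall p, 0 <= f p <= 1) ->
  forall e p, 0 <= induced_factor f e p <= 1.
Proof.
by move=> f01 e p; rewrite /induced_factor; case: ifP => // _;
  have /andP[? ?] := f01 p; lra.
Qed.

Definition adj_fun (F : sgraph V) (p : V * V) : R := (adj F p.1 p.2)%:R.

Lemma adj_fun01 F p : 0 <= adj_fun F p <= 1.
Proof. by rewrite /adj_fun; case: adj => /=; rewrite ?lexx ?ler01. Qed.

(** Injective maps have weight 0, as they would be induced copies of [H]; a
    noninjective map identifies one of at most [#|S * S|] pairs. *)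
Lemma induced_hom_count (F : sgraph V) : ~~ has_induced H F ->
  #|V|%:R * \sum_x hom_weight increasing (induced_factor (adj_fun F)) x <=
  #|{: S * S}|%:R * #|{ffun S -> V}|%:R.
Proof.
move=> noH.
have w01 x : 0 <= hom_weight increasing (induced_factor (adj_fun F)) x <= 1.
  rewrite /hom_weight prodr_ge0 /=;
    last by move=> e _; case/andP: (induced_factor01 (adj_fun01 F) e (x e.1, x e.2)).
  by apply: prodr_ile1 => e _; exact: induced_factor01 (adj_fun01 F) _ _.
have pt x : hom_weight increasing (induced_factor (adj_fun F)) x <=
    \sum_(e : S * S | e.1 != e.2) (x e.1 == x e.2)%:R.
  have [/existsP[e /andP[e1 e2]]|inj] := boolP [exists e : S * S,
    (e.1 != e.2) && (x e.1 == x e.2)].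
    case/andP: (w01 x) => _ /le_trans; apply; rewrite (bigD1 e)//= e2 lerDl.
    by apply: sumr_ge0 => ? _; exact: ler0n.
  suff -> : hom_weight increasing (induced_factor (adj_fun F)) x = 0.
    by apply: sumr_ge0 => ? _; exact: ler0n.
  have injx : injectiveb x.
    apply/injectiveP => s t xst; apply/eqP; move: inj; apply: contraNT => st.
    by apply/existsP; exists (s, t); rewrite /= st xst eqxx.
  have : ~~ [forall s, forall t, adj F (x s) (x t) == adj H s t].
    by move: noH; apply: contra => h; apply/existsP; exists x; rewrite injx.
  rewrite negb_forall => /existsP[s]; rewrite negb_forall => /existsP[t ne].
  have [s' [t' [inc ne']]] : exists s' t', increasing (s',
    t') /\ adj F (x s') (x t') != adj H s' t'.
    have [lt|lt|/val_inj/enum_rank_inj eq] := ltngtP (enum_rank s) (enum_rank t).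
    - by exists s, t.
    - by exists t, s; rewrite adjC [adj H _ _]adjC.
    - by move: ne; rewrite eq !adjxx eqxx.
  rewrite /hom_weight (bigD1 (s', t'))//= {1}/induced_factor /adj_fun /=.
  move: ne'; case: (adj F _ _); case: (adj H s' t') => //= _.
    by rewrite subrr mul0r.
  by rewrite mul0r.
apply: le_trans (ler_wpM2l (ler0n _ _) (ler_sum _ (fun x _ => pt x))) _.
rewrite exchange_big mulr_sumr /=.
have cnt (e : S * S) : e.1 != e.2 ->
    #|V|%:R * \sum_(x : {ffun S -> V}) (x e.1 == x e.2)%:R = #|{ffun S -> V}|%:R :> R.
  move=> ne; have ne' : e.2 != e.1 by rewrite eq_sym.
  rewrite -(sum_upd e.1 (fun x : {ffun S -> V} => (x e.1 == x e.2)%:R)).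
  rewrite -sum1_card natr_sum; apply: eq_bigr => x _.
  rewrite (bigD1 (x e.2))//= upd_same upd_other// eqxx big1 ?addr0// => u ux.
  by rewrite upd_same upd_other// (negbTE ux).
rewrite (eq_bigr (fun=> #|{ffun S -> V}|%:R)); last exact: cnt.
by rewrite sumr_const -[leLHS]mulr_natl ler_wpM2r// ler_nat max_card.
Qed.

(** A pattern has weight at least [d ^+ #|S * S|] for [D], while by the counting lemma
    the total weight for [D] is close to that for [F], which is nearly 0. *)
Lemma pattern_count (F : sgraph V) (D : V * V -> R) (eps d : R) (w b : rel V) :
  (0 < #|V|)%N -> ~~ has_induced H F -> cut_close eps (adj_fun F) D ->
  (forall p, 0 <= D p <= 1) -> 0 < d -> d <= 1 -> 0 <= eps ->
  (forall u v, ~~ w u v -> d <= D (u, v)) ->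
  (forall u v, ~~ b u v -> D (u, v) <= 1 - d) ->
  #|blowup_pattern H w b|%:R * d ^+ #|{: S * S}| <=
  #|{: S * S}|%:R * (eps + #|V|%:R^-1) * #|{ffun S -> V}|%:R.
Proof.
move=> V0 noH cc D01 d0 d1 eps0 hw hb.
set N := #|{: S * S}|; set A : R := #|{ffun S -> V}|%:R.
have cc' e : cut_close eps (induced_factor (adj_fun F) e) (induced_factor D e).
  move=> X Y; rewrite /induced_factor; case: (adj H e.1 e.2); first exact: cc.
  rewrite -normrN -sumrN; apply: le_trans (cc X Y).
  by rewrite le_eqVlt; apply/orP; left; apply/eqP; congr `|_|; apply: eq_bigr => x _; ring.
have := counting_lemma increasing_neq increasing_anti cc' (induced_factor01 (adj_fun01 F))
   (induced_factor01 D01) V0.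
rewrite distrC => /ler_normlW.
set SD := \sum_x _; set SF := \sum_x _; rewrite -/A => h1.
have n0 : 0 < #|V|%:R :> R by rewrite ltr0n.
have h2 : SF <= N%:R * A / #|V|%:R.
  by rewrite ler_pdivlMr// mulrC; exact: induced_hom_count.
have h3 : #|increasing|%:R * eps * A <= N%:R * eps * A.
  by rewrite ler_wpM2r// ler_wpM2r// ler_nat max_card.
have h4 : #|blowup_pattern H w b|%:R * d ^+ N <= SD.
  rewrite -sum1_card natr_sum mulr_suml big_mkcond; apply: ler_sum => x _.
  have w0 : 0 <= hom_weight increasing (induced_factor D) x.
    by apply: prodr_ge0 => e _; case/andP: (induced_factor01 D01 e (x e.1, x e.2)).
  case: ifPn => // px; rewrite mul1r.
  apply: le_trans (_ : d ^+ #|increasing| <= _).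
    by rewrite ler_wiXn2l ?(ltW d0)// max_card.
  rewrite -prodr_const; apply: ler_prod => e ie; rewrite (ltW d0) /=.
  have := forallP (forallP px e.1) e.2; rewrite increasing_neq// /induced_factor.
  by case: ifP => _ /=; [exact: hw | move/hb; lra].
apply: le_trans h4 _.
have -> : N%:R * (eps + #|V|%:R^-1) * A = N%:R * eps * A + N%:R * A / #|V|%:R by ring.
lra.
Qed.

End PatternCount.

Section Sampling.
Context (R : realType) (S I V : finType).

(** Exchanging [x] with the restriction of [y] along [phi] is an involution. *)
Lemma sum_sample (phi : {ffun S -> I}) (g : {ffun S -> V} -> R) : injective phi ->
  #|{ffun S -> V}|%:R * \sum_(y : {ffun I -> V}) g [ffun s => y (phi s)] =
  #|{ffun I -> V}|%:R * \sum_x g x.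
Proof.
move=> inj.
pose put (x : {ffun S -> V}) (y : {ffun I -> V}) : {ffun I -> V} :=
  [ffun j => if [pick s | phi s == j] is Some s then x s else y j].
have putE x y s : put x y (phi s) = x s.
  rewrite ffunE; case: pickP => [t /eqP/inj -> //|/(_ s)]; by rewrite eqxx.
pose T (q : {ffun S -> V} * {ffun I -> V}) :=
  ([ffun s => q.2 (phi s)] : {ffun S -> V}, put q.1 q.2).
have Tinv : involutive T.
  move=> [x y]; rewrite /T /=; congr (_, _).
    by apply/ffunP => s; rewrite ffunE putE.
  apply/ffunP => j; rewrite [LHS]ffunE; case: pickP => [s /eqP <-|no].
    by rewrite ffunE.
  by rewrite ffunE; case: pickP => // s; rewrite no.
transitivity (\sum_(q : {ffun S -> V} * {ffun I -> V}) g q.1).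
  rewrite (reindex_inj (inv_inj Tinv)) /=.
  rewrite -(pair_bigA _ (fun (x : {ffun S -> V}) (y : {ffun I ->
    V}) => g [ffun s => y (phi s)])) /=.
  by rewrite sumr_const mulr_natl.
rewrite -(pair_bigA _ (fun (x : {ffun S -> V}) (y : {ffun I -> V}) => g x)) /= mulr_sumr.
by apply: eq_bigr => x _; rewrite sumr_const mulr_natl.
Qed.

(** Average the hypothesis over all samples [y : I -> V], each with the colours pulled
    back along [y].  A sample that contains a pattern is charged the full amount [c],
    whence the number of patterns in the conclusion. *)
Lemma sampled_cost (H : sgraph S) (w b : rel V) (p c : R) :
  0 <= p -> p <= 1 -> 0 <= c -> (0 < #|V|)%N ->
  symmetric w -> symmetric b -> (forall u v, w u v -> ~~ b u v) ->
  (forall w' b' : rel I, symmetric w' -> symmetric b' ->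
     (forall i j, w' i j -> ~~ b' i j) ->
     (forall phi : {ffun S -> I}, injective phi -> ~~ blowup_pattern H w' b' phi) ->
     c <= p * npairs R (white w') predT + (1 - p) * npairs R (black b') predT) ->
  c * (#|{ffun S -> V}|%:R - #|{ffun S ->
    I}|%:R * #|blowup_pattern H w b|%:R) * #|V|%:R ^+ 2
  <= #|I|%:R ^+ 2 * (p * npairs R w predT + (1 - p) * npairs R b predT) *
    #|{ffun S -> V}|%:R.
Proof.
move=> p0 p1 c0 V0 ws bs wb hyp.
set A : R := #|{ffun S -> V}|%:R; set B : R := #|{ffun S -> I}|%:R.
set M : R := #|{ffun I -> V}|%:R; set n : R := #|V|%:R; set m : R := #|I|%:R.
set P : R := #|blowup_pattern H w b|%:R.
set K := p * npairs R w predT + _.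
pose pull (r : rel V) (y : {ffun I -> V}) : rel I := fun i j => r (y i) (y j).
pose cost (y : {ffun I ->
  V}) : R := p * npairs R (white (pull w y)) predT + (1 - p) *
  npairs R (black (pull b y)) predT.
pose bad (y : {ffun I -> V}) : R := \sum_(phi : {ffun S -> I} | injectiveb phi)
   (blowup_pattern H w b [ffun s => y (phi s)])%:R.
have npairs0 (T : finType) (r : rel T) : 0 <= npairs R r predT.
  by do 2!(apply: sumr_ge0 => ? _); exact: ler0n.
have q0 : 0 <= 1 - p by lra.
have pt y : c - c * bad y <= cost y.
  have [/existsP[phi /andP[iphi pphi]]|none] := boolP [exists phi : {ffun S -> I},
     injectiveb phi && blowup_pattern H w b [ffun s => y (phi s)]].
    have b1 : 1 <= bad y.
      rewrite /bad (bigD1 phi)//= pphi lerDl; apply: sumr_ge0 => ? _; exact: ler0n.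
    have cy : 0 <= cost y by rewrite addr_ge0// mulr_ge0.
    have := ler_wpM2l c0 b1; lra.
  have -> : bad y = 0.
    apply: big1 => phi iphi; case: (boolP (blowup_pattern _ _ _ _)) => // pphi.
    by move/existsP: none; case; exists phi; rewrite iphi.
  rewrite mulr0 subr0; apply: hyp.
  - by move=> i j; rewrite /pull ws.
  - by move=> i j; rewrite /pull bs.
  - by move=> i j; exact: wb.
  move=> phi iphi; apply/negP => pphi; move/existsP: none; case; exists phi.
  rewrite (introT (injectiveP _) iphi) /=; apply/forallP => s; apply/forallP => t.
  by have := forallP (forallP pphi s) t; rewrite /pull !ffunE.
have tot_bad : A * \sum_y bad y <= B * (M * P).
  rewrite exchange_big mulr_sumr /=.
  apply: le_trans (_ : \sum_(phi : {ffun S -> I} | injectiveb phi) M * P <= _).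
    apply: ler_sum => phi /injectiveP iphi.
    rewrite (sum_sample (fun x => (blowup_pattern H w b x)%:R) iphi) ler_wpM2l//.
    rewrite /P -sum1_card natr_sum [leRHS]big_mkcond; apply: ler_sum => x _.
    by rewrite -topredE /=; case: blowup_pattern.
  by rewrite sumr_const -[leLHS]mulr_natl ler_wpM2r ?mulr_ge0// ler_nat max_card.
have tot_pairs (r : rel V) (r' : {ffun I -> V} -> rel I) :
    (forall y i j, r' y i j = (i != j) && r (y i) (y j)) ->
    n ^+ 2 * \sum_y npairs R (r' y) predT <= m ^+ 2 * (M * npairs R r predT).
  move=> r'E.
  have -> : m ^+ 2 * (M * npairs R r predT) =
    \sum_(i : I) \sum_(j : I) M * npairs R r predT.
    by rewrite !sumr_const -mulrnA -[RHS]mulr_natl natrM expr2.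
  rewrite /npairs exchange_big mulr_sumr /=; apply: ler_sum => i _.
  rewrite exchange_big mulr_sumr /=; apply: ler_sum => j _.
  have [ij|ij] := eqVneq i j.
    rewrite (_ : \sum_(y : {ffun I -> V}) _ = 0) ?mulr0 ?mulr_ge0//; first exact: npairs0.
    by apply: big1 => y _; rewrite r'E ij eqxx.
  rewrite -(sum_upd2 i j (fun y : {ffun I -> V} => (r' y i j)%:R)).
  rewrite /M -sum1_card natr_sum mulr_suml; apply: ler_sum => y _; rewrite mul1r.
  apply: ler_sum => u _; apply: ler_sum => v _.
  by rewrite r'E ij /upd2 upd_same upd_other// upd_same.
have tw := tot_pairs w (fun y => white (pull w y)) (fun y i j => erefl).
have tb := tot_pairs b (fun y => black (pull b y)) (fun y i j => erefl).
have tot : n ^+ 2 * \sum_y cost y <= m ^+ 2 * (M * K).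
  rewrite big_split /= -!mulr_sumr /K.
  have := ler_wpM2l p0 tw; have := ler_wpM2l q0 tb; lra.
have M0 : 0 < M.
  rewrite ltr0n; case/card_gt0P: V0 => v0 _; apply/card_gt0P.
  by exists [ffun=> v0].
have sum_pt : c * M - c * \sum_y bad y <= \sum_y cost y.
  have : \sum_y (c - c * bad y) <= \sum_y cost y by apply: ler_sum => y _; exact: pt.
  by rewrite sumrB -mulr_sumr sumr_const -[c *+ _]mulr_natr.
rewrite -(ler_pM2l M0).
have n20 : 0 <= n ^+ 2 by exact: sqr_ge0.
have A0 : 0 <= A by exact: ler0n.
have e1 := ler_wpM2l (mulr_ge0 A0 n20) sum_pt.
have e2 := ler_wpM2l A0 tot.
have e3 := ler_wpM2l (mulr_ge0 c0 n20) tot_bad.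
lra.
Qed.
End Sampling.
Lemma sum_pairs_of_edges (T : finType) (E : {set {set T}}) :
  (forall e, e \in E -> #|e| = 2) ->
  (\sum_(x : T * T) ([set x.1; x.2]%SET \in E) = 2 * #|E|)%N.
Proof.
move=> E2.
transitivity (\sum_(x : T * T | [set x.1; x.2]%SET \in E) 1)%N.
  by rewrite [RHS]big_mkcond; apply: eq_bigr => x _; case: (_ \in E).
rewrite (partition_big (fun x : T * T => [set x.1; x.2]%SET) (mem E))//=.
rewrite mulnC -sum_nat_const; apply: eq_bigr => e eE.
have /cards2P[a [b [ab eE']]] : #|e| == 2 by rewrite E2.
rewrite (eq_bigl (mem [set (a, b); (b, a)]%SET)) => [|[u v]] /=.
  rewrite sum1_card cards2; suff -> : (a, b) != (b, a) by [].
  by rewrite xpair_eqE (negbTE ab).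
rewrite !inE; apply/andP/orP => [[_ /eqP]|].
  rewrite eE' => huv.
  have /finset.set2P[ua|ub] : u \in [set a; b]%SET by rewrite -huv finset.set21.
    have /finset.set2P[ba|<-] : b \in [set u; v]%SET by rewrite huv finset.set22.
      by rewrite -ua -ba eqxx in ab.
    by left; rewrite ua eqxx.
  have /finset.set2P[au|<-] : a \in [set u; v]%SET by rewrite huv finset.set21.
    by rewrite au ub eqxx in ab.
  by right; rewrite ub eqxx.
case=> /eqP[-> ->]; first by rewrite -eE' eE eqxx.
by rewrite finset.setUC -eE' eE eqxx.
Qed.

Section EditBound.
Context (R : realType) (V : finType).
Implicit Types F G : sgraph V.

Lemma sum_adj_diff F G :
  \sum_x `|adj_fun R F x - adj_fun R G x| = 2 * (edit F G)%:R.
Proof.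
set E := ((edges F :\: edges G) :|: (edges G :\: edges F))%SET.
have E2 e : e \in E -> #|e| = 2.
  have sub2 (K : sgraph V) : e \in edges K -> #|e| = 2.
    by case: K => X /= /forall_inP HX /HX/eqP.
  by rewrite !inE => /orP[/andP[_ /sub2]|/andP[_ /sub2]].
have := sum_pairs_of_edges E2; rewrite /edit -/E => /(congr1 (fun n => n%:R : R)).
rewrite natrM natr_sum => <-; apply: eq_bigr => x _.
rewrite /adj_fun /adj !inE; case: (_ \in edges F); case: (_ \in edges G);
  by rewrite /= ?subrr ?normr0 ?subr0 ?sub0r ?normrN ?normr1.
Qed.

(** Over one block the sum of [`|F - G|] is at least the absolute value of the sum of
    [F - G], and there the averages of [F] and [G] are the value of the step function and
    [p] up to [delta].  A sign that is constant on blocks does this for all blocks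
    at once. *)
Lemma edit_ge_step (L : finType) (l : V -> L) F G (p delta : R) :
  cut_close delta (adj_fun R G) (fun=> p) ->
  \sum_x `|step_fun l (adj_fun R F) x - p| - #|{: L * L}|%:R * (delta * #|V|%:R ^+ 2)
  <= 2 * (edit F G)%:R.
Proof.
move=> qr; rewrite -sum_adj_diff.
set f := adj_fun R F; set g := adj_fun R G.
(* The sign of the deviation of the block average from [p]. *)
pose h (a : L * L) : R := if p <= block_avg (pair_label l) f a then 1 else -1.
have h1 a : `|h a| = 1 by rewrite /h; case: ifP; rewrite ?normrN normr1.
have e1 : \sum_x (f x - g x) * h (pair_label l x) <= \sum_x `|f x - g x|.
  by apply: ler_sum => x _; apply: le_trans (ler_norm _) _; rewrite normrM h1 mulr1.
apply: le_trans e1.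
have -> : \sum_x (f x - g x) * h (pair_label l x) =
   \sum_x (step_fun l f x - p) * h (pair_label l x) - \sum_x (g x - p) * h (pair_label l x).
  rewrite -sumrB /step_fun.
  have := cond_avgE (pair_label l) f h => ce.
  rewrite (eq_bigr (fun x => f x * h (pair_label l x) - g x * h (pair_label l x)));
    last by move=> x _; ring.
  rewrite [LHS]sumrB.
  have -> : \sum_x f x * h (pair_label l x) =
     \sum_x cond_avg (pair_label l) f x * h (pair_label l x) by exact: esym ce.
  by rewrite -[LHS]sumrB; apply: eq_bigr => x _; ring.
apply: lerB.
  apply: ler_sum => x _; rewrite /h -/(cond_avg (pair_label l) f x) /step_fun.
  by case: (leP p (cond_avg _ _ _)) => hp;
    rewrite ?mulr1 ?mulrN1; [rewrite ger0_norm ?subr_ge0|rewrite ltr0_norm ?subr_lt0].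
rewrite (partition_big (pair_label l) predT)//=.
have -> : #|{: L * L}|%:R * (delta * #|V|%:R ^+ 2) = \sum_(a : L * L) delta * #|V|%:R ^+ 2.
  by rewrite sumr_const mulr_natl.
apply: ler_sum => -[a a'] _.
rewrite (eq_bigr (fun x => (g x - p) * h (a, a'))); last by move=> x /eqP ->.
rewrite -mulr_suml; apply: le_trans (ler_norm _) _; rewrite normrM h1 mulr1.
have := qr (fun u => l u == a) (fun u => l u == a').
by congr (`|_| <= _); apply: eq_bigl => x; rewrite xpair_eqE.
Qed.

Lemma step_fun_sym (L : finType) (l : V -> L) F u v :
  step_fun l (adj_fun R F) (u, v) = step_fun l (adj_fun R F) (v, u).
Proof.
have sw : injective (fun x : V * V => (x.2, x.1)) by move=> [a b] [c d] [-> ->].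
rewrite /step_fun /cond_avg /block_avg /pair_label /=; congr (_ / _%:R).
  rewrite (reindex_inj sw) /=; apply: eq_big => [x|x _]; rewrite ?xpair_eqE 1?andbC//.
  by rewrite /adj_fun adjC.
rewrite -!sum1_card (reindex_inj sw) /=; apply: eq_bigl => x.
by rewrite !inE !xpair_eqE andbC.
Qed.

End EditBound.

(** White, black and gray blocks cost about [p], [1 - p] and 0 at the least. *)
Lemma colour_cost_le (R : realType) (p d D : R) :
  0 <= p -> p <= 1 -> d <= 4^-1 -> 0 < d ->
  p * (D < d)%R%:R + (1 - p) * (1 - d < D)%R%:R - d <= `|D - p|.
Proof.
move=> p0 p1 d1 d0.
have n1 := ler_norm (D - p); have n2 := ler_norm (p - D).
rewrite distrC in n2; have n3 := normr_ge0 (D - p).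
by case: (ltP D d) => h; case: (ltP (1 - d) D) => h'; rewrite /= ?mulr0 ?mulr1; lra.
Qed.

(** The constants are chosen in this order: the sample size [m], the threshold [d] for
    white and black, the precision [er] of the step function (so small that a sample
    rarely contains a pattern), which bounds the number [K] of labels, and finally
    the quasirandomness [delta] needed on [K ^ 2] blocks. *)
Lemma edit_lower_bound (R : realType) (S : finType) (H : sgraph S) (p c : R) :
  0 <= p -> p <= 1 ->
  (forall eps : R, 0 < eps -> exists2 m : nat, (0 < m)%N &
     forall w b : rel 'I_m, symmetric w -> symmetric b ->
     (forall i j, w i j -> ~~ b i j) ->
     (forall phi : {ffun S -> 'I_m}, injective phi -> ~~ blowup_pattern H w b phi) ->
     (c - eps) * m%:R ^+ 2 <= p * npairs R (white w) predT + (1 - p) *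
       npairs R (black b) predT) ->
  forall eps : R, 0 < eps -> exists2 delta : R, 0 < delta &
  exists n0 : nat, forall (V : finType) (F G : sgraph V), (n0 <= #|V|)%N ->
    cut_close delta (adj_fun R G) (fun=> p) -> ~~ has_induced H F ->
    (c - eps) * #|V|%:R ^+ 2 <= 2 * (edit F G)%:R.
Proof.
move=> p0 p1 hyp eps eps0.
have [ce|ce] := leP c eps.
  exists 1 => //; exists 0%N => V F G _ _ _.
  apply: le_trans (_ : 0 <= _); last by rewrite mulr_ge0.
  by rewrite mulr_le0_ge0 ?subr_le0 ?sqr_ge0.
have [m m0 {}hyp] := hyp (eps / 4) ltac:(lra).
pose d : R := Num.min (eps / 4) 4^-1.
have d0 : 0 < d by rewrite lt_min; apply/andP; split; lra.
have d1 : d <= 4^-1 by rewrite ge_min lexx orbT.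
have d2 : d <= eps / 4 by rewrite ge_min lexx.
pose N := #|{: S * S}|; pose B : R := #|{ffun S -> 'I_m}|%:R.
have B0 : 0 <= B by exact: ler0n.
pose kappa := eps / (4 * c).
have c_gt0 : 0 < c by lra.
have k0 : 0 < kappa by rewrite divr_gt0// mulr_gt0.
have dN : 0 < d ^+ N by rewrite exprn_gt0.
pose er := kappa * d ^+ N / (2 * (B + 1) * (N%:R + 1)).
have N0 : 0 <= (N%:R : R) by exact: ler0n.
have den0 : 0 < 2 * (B + 1) * (N%:R + 1) :> R by rewrite !mulr_gt0//; lra.
have er0 : 0 < er by rewrite divr_gt0// mulr_gt0.
have [K hK] := weak_regularity er0.
pose delta : R := eps / (4 * (K%:R ^+ 2 + 1)).
have K0 : 0 <= (K%:R ^+ 2 : R) by exact: sqr_ge0.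
have delta0 : 0 < delta by rewrite divr_gt0// mulr_gt0//; lra.
exists delta => //; exists (Num.Def.archi_bound er^-1) => V F G nV qr noH.
set n : R := #|V|%:R.
have ern : er^-1 < n.
  apply: lt_le_trans (archi_boundP _) _; first by rewrite invr_ge0 ltW.
  by rewrite ler_nat.
have n0 : 0 < n by apply: le_lt_trans ern; rewrite invr_ge0 ltW.
have V0 : (0 < #|V|)%N by rewrite -(ltr0n R).
have inv_n : n^-1 <= er by rewrite invf_ple ?posrE// ltW.
set f := adj_fun R F.
have f01 := adj_fun01 R F.
have [L [l [cL cc]]] := hK V f V0 f01.
set D := step_fun l f in cc.
have D01 : forall x, 0 <= D x <= 1 by exact: cond_avg_bound f01.
pose w : rel V := fun u v => D (u, v) < d.
pose b : rel V := fun u v => 1 - d < D (u, v).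
have ws : symmetric w by move=> u v; rewrite /w /D step_fun_sym.
have bs : symmetric b by move=> u v; rewrite /b /D step_fun_sym.
have wb : forall u v, w u v -> ~~ b u v by move=> u v; rewrite /w /b -leNgt; lra.
set A : R := #|{ffun S -> V}|%:R.
have A0 : 0 < A.
  rewrite ltr0n; case/card_gt0P: V0 => v0 _; apply/card_gt0P.
  by exists [ffun=> v0].
set P : R := #|blowup_pattern H w b|%:R.
have BP : B * P <= kappa * A.
  have hw u v : ~~ w u v -> d <= D (u, v) by rewrite /w -leNgt.
  have hb u v : ~~ b u v -> D (u, v) <= 1 - d by rewrite /b -leNgt.
  have d1' : d <= 1 by lra.
  have pc := pattern_count V0 noH cc D01 d0 d1' (ltW er0) hw hb.
  rewrite -/A -/N -/P -/n in pc.
  have pc2 : P * d ^+ N <= N%:R * (2 * er) * A.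
    apply: le_trans pc _; rewrite ler_wpM2r ?(ltW A0)// ler_wpM2l//; lra.
  rewrite -(ler_pM2r dN) -mulrA; apply: le_trans (ler_wpM2l B0 pc2) _.
  have -> : B * (N%:R * (2 * er) * A) =
    (B * N%:R / ((B + 1) * (N%:R + 1))) * (kappa * A * d ^+ N).
    by rewrite /er; field; rewrite !gt_eqF//; lra.
  rewrite ler_piMl//; first exact: (mulr_ge0 (mulr_ge0 (ltW k0) (ltW A0)) (ltW dN)).
  rewrite ler_pdivrMr ?mul1r; last by rewrite mulr_gt0//; lra.
  by have := mulr_ge0 B0 N0; lra.
set Kc := p * npairs R w predT + (1 - p) * npairs R b predT.
have sc : (c - eps / 4) * m%:R ^+ 2 * (A - B * P) * n ^+ 2 <= m%:R ^+ 2 * Kc * A.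
  have c0 : 0 <= (c - eps / 4) * m%:R ^+ 2 by rewrite mulr_ge0 ?sqr_ge0//; lra.
  have := @sampled_cost R S 'I_m V H w b p _ p0 p1 c0 V0 ws bs wb hyp.
  by rewrite card_ord.
have Kc_ge : (c - eps / 2) * n ^+ 2 <= Kc.
  have m2 : 0 < m%:R ^+ 2 :> R by rewrite exprn_gt0// ltr0n.
  have n2 : 0 < n ^+ 2 by rewrite exprn_gt0.
  have ck : c * kappa = eps / 4 by rewrite /kappa; field; rewrite gt_eqF.
  have c1 : 0 <= c - eps / 4 by lra.
  rewrite -(ler_pM2l (mulr_gt0 m2 A0)).
  have s1 : m%:R ^+ 2 * n ^+ 2 * ((c - eps / 4) * (B * P)) <=
      m%:R ^+ 2 * n ^+ 2 * ((c - eps / 4) * (kappa * A)).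
    by rewrite ler_wpM2l ?mulr_ge0 ?sqr_ge0// ler_wpM2l.
  have s2 : m%:R ^+ 2 * n ^+ 2 * A * ((c - eps / 4) * kappa) <=
    m%:R ^+ 2 * n ^+ 2 * A * (eps / 4).
    rewrite ler_wpM2l ?mulr_ge0 ?sqr_ge0 ?(ltW A0)//.
    by rewrite mulrBl ck; have := mulr_ge0 (ltW eps0) (ltW k0); lra.
  lra.
have Dp : Kc - d * n ^+ 2 <= \sum_x `|D x - p|.
  have -> : Kc = \sum_(x : V * V) (p * (w x.1 x.2)%:R + (1 - p) * (b x.1 x.2)%:R).
    rewrite sum_pairE /Kc /npairs !mulr_sumr -big_split; apply: eq_bigr => u _.
    by rewrite !mulr_sumr -big_split.
  have -> : d * n ^+ 2 = \sum_(x : V * V) d.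
    by rewrite sumr_const card_prod -[RHS]mulr_natl natrM mulrC expr2.
  by rewrite -sumrB; apply: ler_sum => -[u v] _; exact: colour_cost_le.
have := edit_ge_step l F qr; rewrite -/f -/D -/n.
have -> : #|{: L * L}|%:R * (delta * n ^+ 2) = #|L|%:R ^+ 2 * delta * n ^+ 2 :> R.
  by rewrite card_prod natrM expr2; ring.
have Ld : #|L|%:R ^+ 2 * delta * n ^+ 2 <= eps / 4 * n ^+ 2.
  rewrite ler_wpM2r ?sqr_ge0//.
  have L2 : #|L|%:R ^+ 2 <= K%:R ^+ 2 :> R by rewrite lerXn2r ?nnegrE// ler_nat.
  apply: le_trans (ler_wpM2r (ltW delta0) L2) _.
  rewrite /delta mulrA ler_pdivrMr; last by lra.
  by have := mulr_ge0 (ltW eps0) K0; lra.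
have dn : d * n ^+ 2 <= eps / 4 * n ^+ 2 by rewrite ler_wpM2r ?sqr_ge0.
lra.
Qed.
(** * Quasirandomness of G(n, p) *)

Section RandomGraph.
Context (R : realType) (n : nat) (p : R).
Hypothesis p0 : 0 <= p.
Hypothesis p1 : p <= 1.
Implicit Types G : sgraph 'I_n.

Definition gnp_weight G : R :=
  p ^+ #|edges G| * (1 - p) ^+ ('C(n, 2) - #|edges G|).

Definition gnp_expect (X : sgraph 'I_n -> R) : R := \sum_G gnp_weight G * X G.

Lemma gnp_weight_ge0 G : 0 <= gnp_weight G.
Proof. by rewrite /gnp_weight mulr_ge0// exprn_ge0// subr_ge0. Qed.

Lemma edge_card G e : e \in edges G -> #|e| == 2.
Proof. by case: G => E /= /forall_inP h /h. Qed.

Lemma card_pairs : #|[set e : {set 'I_n} | #|e| == 2]%SET| = 'C(n, 2).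
Proof. by rewrite card_draws card_ord. Qed.

Lemma edges_sub G : edges G \subset [set e : {set 'I_n} | #|e| == 2]%SET.
Proof. by apply/fintype.subsetP => e /edge_card; rewrite inE. Qed.

Lemma card_edges_le G : (#|edges G| <= 'C(n, 2))%N.
Proof.
rewrite -card_pairs; apply: subset_leq_card; exact: edges_sub.
Qed.

(** Expand the product of [F e + F' e] over all sets [e] of vertices; only the sets of
    pairs contribute, since [F] vanishes elsewhere. *)
Lemma gnp_mass : \sum_G gnp_weight G = 1.
Proof.
pose F (e : {set 'I_n}) : R := if #|e| == 2 then p else 0.
pose F' (e : {set 'I_n}) : R := if #|e| == 2 then 1 - p else 1.
have : \prod_(e : {set 'I_n}) (F e + F' e) = 1.
  by apply: big1 => e _; rewrite /F /F'; case: ifP => _; ring.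
rewrite bigA_distr => <-.
rewrite [RHS](bigID (fun J : {set {set 'I_n}} => [forall e in J, #|e| == 2])) /=.
rewrite [X in _ = _ + X]big1 ?addr0; last first.
  move=> J; rewrite negb_forall => /existsP[e]; rewrite negb_imply => /andP[eJ e2].
  by rewrite (bigD1 e)//= eJ /F (negbTE e2) mul0r.
rewrite [RHS](reindex_omap (@edges _) insub) /=; last first.
  by move=> J hJ; rewrite insubT.
apply: eq_big => [G|G _].
  by rewrite valK eqxx andbT; symmetry; apply/forall_inP => e; exact: edge_card.
rewrite (bigID (mem (edges G))) /=; congr (_ * _).
  rewrite -prodr_const; apply: eq_bigr => e eG.
  by rewrite eG /F (edge_card eG).
have -> : ('C(n, 2) - #|edges G| = #|([set e : {set 'I_n} | #|e| == 2] :\: edges G)%SET|)%N.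
  by rewrite -card_pairs cardsD (finset.setIidPr (edges_sub G)).
rewrite -prodr_const big_mkcond [RHS]big_mkcond; apply: eq_bigr => e _.
by rewrite !inE /F'; case: (e \in edges G) => //=; case: ifP.
Qed.

Lemma toggle_subproof G (e : {set 'I_n}) : #|e| == 2 ->
  [forall f in (if e \in edges G then edges G :\ e else e |: edges G)%SET, #|f| == 2].
Proof.
move=> e2; apply/forall_inP => f; case: ifP => _; rewrite !inE.
  by move=> /andP[_]; exact: edge_card.
by case/orP => [/eqP->|/edge_card].
Qed.

Definition toggle (e : {set 'I_n}) (e2 : #|e| == 2) G : sgraph 'I_n := SGraph
  (toggle_subproof G e2).

Lemma toggleK (e : {set 'I_n}) (e2 : #|e| == 2) : involutive (toggle e2).
Proof.
move=> G; apply/val_inj; rewrite /=.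
case: (boolP (e \in edges G)) => eG /=.
  by rewrite !inE eqxx /= finset.setD1K.
by rewrite !inE eqxx /= finset.setU1K.
Qed.

Lemma in_toggle (e : {set 'I_n}) (e2 : #|e| == 2) G (f : {set 'I_n}) :
  (f \in edges (toggle e2 G)) = (f \in edges G) (+) (f == e).
Proof.
rewrite /toggle /=; case: ifPn => eG; rewrite !inE; case: eqVneq => [->|//] /=.
- by rewrite eG.
- by rewrite addbF.
- by rewrite (negbTE eG).
- by rewrite addbF.
Qed.

(** Adding [e] to a graph without [e] multiplies its weight by [p / (1 - p)] and turns
    the factor [- p] into [1 - p], so the terms of the sum cancel in pairs. *)
Lemma gnp_expect_factor0 (e : {set 'I_n}) (Y : sgraph 'I_n -> R) (e2 : #|e| == 2) :
  (forall G, Y (toggle e2 G) = Y G) ->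
  gnp_expect (fun G => ((e \in edges G)%:R - p) * Y G) = 0.
Proof.
move=> hY; rewrite /gnp_expect.
pose t G := gnp_weight G * (((e \in edges G)%:R - p) * Y G).
rewrite -[LHS]/(\sum_G t G).
have anti G : e \notin edges G ->
    gnp_weight (toggle e2 G) * ((1 - p) * Y G) = gnp_weight G * (p * Y G).
  move=> eG; have := card_edges_le (toggle e2 G); rewrite /gnp_weight.
  have -> : #|edges (toggle e2 G)| = #|edges G|.+1.
    by rewrite /toggle /= (negbTE eG) cardsU1 eG.
  move=> /subnSK <-; rewrite [p ^+ _.+1]exprS [(1 - p) ^+ _.+1 in RHS]exprS.
  by move: (p ^+ _) ((1 - p) ^+ _) => x y; ring.
have tK G : t (toggle e2 G) = - t G.
  rewrite /t hY in_toggle eqxx addbT; case: (boolP (e \in edges G)) => eG /=.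
    have := anti (toggle e2 G); rewrite in_toggle eqxx addbT negbK => /(_ eG).
    rewrite toggleK hY => h; rewrite sub0r mulNr mulrN -h; ring.
  by rewrite (anti _ eG); ring.
have : \sum_G t G = - \sum_G t G.
  rewrite {1}(reindex_inj (inv_inj (toggleK e2))) -sumrN.
  by apply: eq_bigr => G _; exact: tK.
move: (\sum_G t G) => z; lra.
Qed.

Definition dev G (u v : 'I_n) : R := (adj G u v)%:R - p.

Lemma dev_le1 G u v : `|dev G u v| <= 1.
Proof. by rewrite /dev ler_norml; have := p0; have := p1;
  case: (adj G u v) => /= ? ?; apply/andP; split; lra. Qed.

(** The signed count of homomorphic 4-cycles of the deviation from [p], which controls
    the cut norm and has small expectation. *)
Definition c4_dev G : R :=
  \sum_u \sum_u' \sum_v \sum_v' dev G u v * dev G u' v * (dev G u v' * dev G u' v').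

Lemma set2_eq (T : finType) (a b c d : T) :
  [set a; b]%SET = [set c; d]%SET -> (a == c) || (a == d).
Proof. by move=> h; have := finset.set21 a b; rewrite h !inE. Qed.

Lemma expect_c4_term u u' v v' : uniq [:: u; u'; v; v'] ->
  gnp_expect (fun G => dev G u v * dev G u' v * (dev G u v' * dev G u' v')) = 0.
Proof.
rewrite /= !inE !negb_or => /and4P[/and3P[uu' uv uv'] /andP[u'v u'v'] vv' _].
have e2 : #|[set u; v]%SET| == 2 by rewrite cards2 uv.
rewrite -[RHS](gnp_expect_factor0 (Y := fun G => dev G u' v * (dev G u v' *
  dev G u' v')) (e2 := e2)).
  by apply: eq_bigr => G _; rewrite /dev /adj !mulrA.
move=> G; rewrite /dev /adj !in_toggle.
have n1 : [set u'; v]%SET == [set u; v]%SET = false.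
  by apply/negbTE/eqP => /set2_eq; rewrite eq_sym (negbTE uu') (negbTE u'v).
have n2 : [set u; v']%SET == [set u; v]%SET = false.
  apply/negbTE/eqP => h; have := finset.set22 u v'; rewrite h !inE.
  by rewrite eq_sym (negbTE uv') eq_sym (negbTE vv').
have n3 : [set u'; v']%SET == [set u; v]%SET = false.
  by apply/negbTE/eqP => /set2_eq; rewrite eq_sym (negbTE uu') (negbTE u'v).
by rewrite n1 n2 n3 !addbF.
Qed.

(** If [u], [u'], [v], [v'] are distinct, the pair [u v] differs from the three other
    pairs, so the term has mean 0; the other terms are at most 1. *)
Lemma expect_c4_le : gnp_expect c4_dev <= 6 * n%:R ^+ 3.
Proof.
have swap : gnp_expect c4_dev = \sum_u \sum_u' \sum_v \sum_v'
    gnp_expect (fun G => dev G u v * dev G u' v * (dev G u v' * dev G u' v')).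
  rewrite /gnp_expect /c4_dev.
  under eq_bigr => G _ do rewrite mulr_sumr.
  rewrite exchange_big; apply: eq_bigr => u _.
  under eq_bigr => G _ do rewrite mulr_sumr.
  rewrite exchange_big; apply: eq_bigr => u' _.
  under eq_bigr => G _ do rewrite mulr_sumr.
  rewrite exchange_big; apply: eq_bigr => v _.
  under eq_bigr => G _ do rewrite mulr_sumr.
  by rewrite exchange_big.
rewrite swap.
pose d (u u' v v' : 'I_n) : R := (u == u')%:R + (u == v)%:R + (u == v')%:R + (u' == v)%:R
  + (u' == v')%:R + (v == v')%:R.
have -> : 6 * n%:R ^+ 3 = \sum_(u < n) \sum_(u' < n) \sum_(v < n) \sum_(v' < n) d u u' v v'.
  have E (x : 'I_n) : \sum_(x' < n) (x == x')%:R = 1 :> R.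
    rewrite (bigD1 x)//= eqxx big1 ?addr0// => y; rewrite eq_sym.
    by move/negbTE ->.
  have C (r : R) : \sum_(x < n) r = n%:R * r by rewrite sumr_const card_ord mulr_natl.
  symmetry; rewrite (eq_bigr (fun=> 6 * n%:R ^+ 2)) ?C; first by ring.
  move=> u _; rewrite (eq_bigr (fun u' => 5 * n%:R + n%:R ^+ 2 * (u == u')%:R)).
    by rewrite big_split /= C -mulr_sumr E; ring.
  move=> u' _; rewrite (eq_bigr (fun v => 3 + n%:R *
    ((u == u')%:R + (u == v)%:R + (u' == v)%:R))).
    by rewrite big_split /= C -mulr_sumr !big_split /= !E C; ring.
  by move=> v _; rewrite /d !big_split /= !E !C; ring.
apply: ler_sum => u _; apply: ler_sum => u' _; apply: ler_sum => v _;
  apply: ler_sum => v' _.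
have d0 : 0 <= d u u' v v' by rewrite /d !addr_ge0.
have [un|] := boolP (uniq [:: u; u'; v; v']); first by rewrite expect_c4_term.
move=> nu; apply: le_trans (_ : 1 <= _).
  rewrite -gnp_mass; apply: ler_sum => G _; rewrite ler_piMr ?gnp_weight_ge0//.
  apply: le_trans (ler_norm _) _; rewrite !normrM.
  by rewrite !mulr_ile1 ?mulr_ge0 ?dev_le1.
move: nu; rewrite /= !inE !negb_and !negb_or !negbK /d.
case: (u == u'); case: (u == v); case: (u == v'); case: (u' == v); case: (u' == v');
  case: (v == v') => //= _; lra.
Qed.

Lemma c4_dev_sqr G : c4_dev G = \sum_v \sum_v' (\sum_u dev G u v * dev G u v') ^+ 2.
Proof.
rewrite /c4_dev.
under eq_bigr => u _ do rewrite exchange_big /=.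
rewrite exchange_big /=; apply: eq_bigr => v _.
under eq_bigr => u _ do rewrite exchange_big /=.
rewrite exchange_big /=; apply: eq_bigr => v' _.
rewrite expr2 big_distrlr /=; apply: eq_bigr => u _; apply: eq_bigr => u' _; ring.
Qed.

Lemma c4_dev_ge0 G : 0 <= c4_dev G.
Proof. by rewrite c4_dev_sqr; do 2!(apply: sumr_ge0 => ? _); exact: sqr_ge0. Qed.

(** Cauchy-Schwarz over [u] and then over pairs [(v, v')]. *)
Lemma c4_dev_cut_close G (delta : R) : 0 <= delta ->
  c4_dev G <= delta ^+ 4 * n%:R ^+ 4 -> cut_close delta (adj_fun R G) (fun=> p).
Proof.
move=> d0 hQ S T; rewrite card_ord.
have -> : \sum_(x : 'I_n * 'I_n | S x.1 && T x.2) (adj_fun R G x - p) =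
    \sum_(u | S u) \sum_(v | T v) dev G u v.
  by rewrite pair_big.
set s := \sum_(u | S u) _.
have n0 : 0 <= n%:R :> R by exact: ler0n.
have cS (X : pred 'I_n) :
  #|X|%:R <= n%:R :> R by rewrite ler_nat -[leqRHS]card_ord max_card.
pose c v v' := \sum_u dev G u v * dev G u v'.
have s2 : s ^+ 2 <= n%:R * \sum_(x : 'I_n * 'I_n | T x.1 && T x.2) c x.1 x.2.
  apply: le_trans (sqr_sum_le S _) _.
  have -> : \sum_(x : 'I_n * 'I_n | T x.1 && T x.2) c x.1 x.2 =
    \sum_u (\sum_(v | T v) dev G u v) ^+ 2.
    rewrite -(pair_big T T c) /= /c.
    under eq_bigr => v _ do rewrite exchange_big /=.
    rewrite exchange_big /=; apply: eq_bigr => u _.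
    by rewrite expr2 big_distrlr.
  apply: ler_pM => //; first by apply: sumr_ge0 => u _; exact: sqr_ge0.
  rewrite [leLHS]big_mkcond; apply: ler_sum => u _.
  by case: ifP => // _; exact: sqr_ge0.
have s4 : s ^+ 4 <= n%:R ^+ 4 * c4_dev G.
  have -> : s ^+ 4 = (s ^+ 2) ^+ 2 by rewrite -exprM.
  apply: le_trans (_ : (n%:R * \sum_(x : 'I_n *
    'I_n | T x.1 && T x.2) c x.1 x.2) ^+ 2 <= _).
    rewrite lerXn2r// ?nnegrE ?sqr_ge0//; exact: le_trans (sqr_ge0 s) s2.
  rewrite exprMn (_ : n%:R ^+ 4 = n%:R ^+ 2 * n%:R ^+ 2); last by rewrite -exprD.
  rewrite -mulrA ler_wpM2l ?sqr_ge0//.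
  apply: le_trans (sqr_sum_le [pred x : 'I_n * 'I_n | T x.1 && T x.2] _) _.
  apply: ler_pM => //.
  - by apply: sumr_ge0 => x _; exact: sqr_ge0.
  - rewrite -natrX ler_nat; apply: leq_trans (max_card _) _.
    by rewrite card_prod card_ord.
  rewrite c4_dev_sqr (pair_bigA _ (fun v v' => c v v' ^+ 2)) /=.
  rewrite [leLHS]big_mkcond; apply: ler_sum => x _.
  by case: ifP => // _; exact: sqr_ge0.
have s4' : s ^+ 4 <= (delta * n%:R ^+ 2) ^+ 4.
  apply: le_trans s4 _; have ->
    : (delta * n%:R ^+ 2) ^+ 4 = n%:R ^+ 4 * (delta ^+ 4 * n%:R ^+ 4) by ring.
  by rewrite ler_wpM2l// exprn_ge0.
rewrite -(@ler_pXn2r _ 4)// ?nnegrE ?mulr_ge0 ?sqr_ge0//.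
by rewrite -normrX ger0_norm// (_ : s ^+ 4 = (s ^+ 2) ^+ 2) ?sqr_ge0// -exprM.
Qed.

(** Markov's inequality for the nonnegative [c4_dev]. *)
Lemma quasirandom_prob (delta : R) : (0 < n)%N -> 0 < delta ->
  1 - 6 / (delta ^+ 4 * n%:R) <=
  gnp_prob p (fun G : sgraph 'I_n => c4_dev G <= delta ^+ 4 * n%:R ^+ 4).
Proof.
move=> n_gt0 d0; set a := delta ^+ 4 * n%:R ^+ 4.
have n0 : 0 < n%:R :> R by rewrite ltr0n.
have a0 : 0 < a by rewrite mulr_gt0// exprn_gt0.
set P := gnp_prob _ _.
have mass : P + \sum_(G : sgraph 'I_n | ~~ (c4_dev G <= a)) gnp_weight G = 1.
  by rewrite -gnp_mass [RHS](bigID (fun G : sgraph 'I_n => c4_dev G <= a)).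
have markov : a * \sum_(G : sgraph 'I_n | ~~ (c4_dev G <= a)) gnp_weight G <= 6 * n%:R ^+ 3.
  apply: le_trans expect_c4_le; rewrite mulr_sumr big_mkcond.
  apply: ler_sum => G _; rewrite mulrC; case: ifPn => [|_].
    by rewrite -ltNge => /ltW h; rewrite ler_wpM2l// gnp_weight_ge0.
  by rewrite mulr_ge0 ?gnp_weight_ge0 ?c4_dev_ge0.
have -> : 6 / (delta ^+ 4 * n%:R) = (6 * n%:R ^+ 3) / a.
  by rewrite /a; field; rewrite !gt_eqF.
rewrite lerBlDr -lerBlDl;
  have -> : 1 - P = \sum_(G : sgraph 'I_n | ~~ (c4_dev G <= a)) gnp_weight G by lra.
by rewrite ler_pdivlMr// mulrC.
Qed.

Lemma gnp_prob_le1 (A : pred (sgraph 'I_n)) : gnp_prob p A <= 1.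
Proof.
rewrite -gnp_mass /gnp_prob big_mkcond; apply: ler_sum => G _.
by case: ifP => // _; exact: gnp_weight_ge0.
Qed.

Lemma gnp_prob_sub (A B : pred (sgraph 'I_n)) :
  (forall G, A G -> B G) -> gnp_prob p A <= gnp_prob p B.
Proof.
move=> AB; rewrite /gnp_prob [leLHS]big_mkcond [leRHS]big_mkcond; apply: ler_sum => G _.
case: ifPn => [/AB ->//|_]; case: ifP => // _; exact: gnp_weight_ge0.
Qed.

Lemma gnp_probC (A : pred (sgraph 'I_n)) : gnp_prob p A + gnp_prob p (predC A) = 1.
Proof. by rewrite -gnp_mass [RHS](bigID A). Qed.

End RandomGraph.
(** * Editing to an independent set and two cliques *)

Lemma K33_across (i j : 'I_3) : adj K33 (inl i) (inr j).
Proof. by rewrite /adj /=; apply/imset2P; exists i j. Qed.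

Lemma K33_same_side (i j : 'I_3) :
  adj K33 (inl i) (inl j) = false /\ adj K33 (inr i) (inr j) = false.
Proof.
split; apply/negbTE/negP; rewrite /adj /= => /imset2P[a b _ _] h.
  have : (inr b : 'I_3 + 'I_3) \in [set inl i; inl j]%SET by rewrite h finset.set22.
  by rewrite !inE.
have : (inl a : 'I_3 + 'I_3) \in [set inr i; inr j]%SET by rewrite h finset.set21.
by rewrite !inE.
Qed.

Section UpperBound.
Context (R : realType) (T : finType) (G : sgraph T).
Implicit Types (l : {ffun T -> 'I_3}) (e : {set T}) (c : 'I_3).

Definition monochromatic c l e := [forall v in e, l v == c].

Definition kept l e := (#|e| == 2) &&
  (~~ monochromatic ord0 l e && [|| e \in edges G,
    monochromatic 1 l e | monochromatic ord_max l e]).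

Lemma homogenise_subproof l : [forall e in [set e | kept l e]%SET, #|e| == 2].
Proof. by apply/forall_inP => e; rewrite inE => /andP[]. Qed.

(** Class 0 becomes independent, classes 1 and 2 become cliques. *)
Definition homogenise l : sgraph T := SGraph (homogenise_subproof l).

Lemma monochromatic2 c l u v : monochromatic c l [set u; v]%SET = (l u == c) && (l v == c).
Proof.
apply/forall_inP/andP => [h|[hu hv] x].
  by split; apply: h; rewrite !inE eqxx ?orbT.
by rewrite !inE => /orP[]/eqP->.
Qed.

(** On either side of an induced K33 two vertices with the same label have label 0, for
    otherwise they would be adjacent.  Such a vertex exists on each side: three labels
    either repeat or take all three values.  But vertices of opposite sides are
    adjacent. *)
Lemma homogenise_free l : Forb K33 (homogenise l).
Proof.
rewrite /Forb; apply/negP => /existsP[f /andP[/injectiveP finj /forallP fadj]].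
have fE x y : adj (homogenise l) (f x) (f y) = adj K33 x y.
  by apply/eqP; exact: forallP (fadj x) y.
have side (s : 'I_3 -> 'I_3 + 'I_3) : injective s ->
    (forall i j, adj K33 (s i) (s j) = false) -> exists i, l (f (s i)) = ord0.
  move=> sinj snon; pose t i := l (f (s i)).
  have [tinj|] := boolP (injectiveb t).
    have [t' _ tK] := injF_bij (injectiveP _ tinj).
    by exists (t' ord0); exact: tK.
  move=> /injectivePn[i [j ij tij]]; exists i.
  have := fE (s i) (s j); rewrite snon /adj inE /kept !monochromatic2 => /negbT.
  have -> : #|[set f (s i); f (s j)]%SET| == 2.
    by rewrite cards2 (inj_eq finj) (inj_eq sinj) ij.
  rewrite -/(t i) -/(t j) -tij !andbb /=.
  have I3 (a : 'I_3) : [|| a == ord0, a == 1 | a == ord_max].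
    by case: a => -[|[|[|//]]] ?; rewrite -!val_eqE.
  have := I3 (t i); case: (eqVneq (t i) ord0) => //= _.
  by case/orP => ->; rewrite !orbT.
have [i li] := side inl (@inl_inj _ _) (fun i j => proj1 (K33_same_side i j)).
have [j lj] := side inr (@inr_inj _ _) (fun i j => proj2 (K33_same_side i j)).
by have := fE (inl i) (inr j);
  rewrite K33_across /adj inE /kept !monochromatic2 li lj eqxx andbF.
Qed.

Lemma edit_homogenise l : (edit (homogenise l) G <=
  \sum_(e : {set T} | #|e| == 2) (if e \in edges G then (monochromatic ord0 l e : nat)
    else monochromatic 1%R l e + monochromatic ord_max l e))%N.
Proof.
rewrite /edit -sum1_card [leqRHS]big_mkcond [leqLHS]big_mkcond /=; apply: leq_sum => e _.
rewrite !inE /kept; case: (boolP (e \in edges G)) => eG /=.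
  have -> : #|e| == 2 by case: (G) eG => E /= /forall_inP h /h.
  by rewrite andbT; case: (monochromatic ord0 l e).
rewrite andbF orbF; case: (#|e| == 2) => //=.
by case: (monochromatic ord0 l e) => //=; case: (monochromatic 1 l e);
  case: (monochromatic ord_max l e).
Qed.

Lemma expect_monochromatic (wt : 'I_3 -> R) c e : \sum_i wt i = 1 ->
  \sum_(l : {ffun T -> 'I_3}) (\prod_v wt (l v)) * (monochromatic c l e)%:R = wt c ^+ #|e|.
Proof.
move=> wt1.
have -> : wt c ^+ #|e| = \prod_v \sum_i wt i * (if v \in e then (i == c)%:R else 1).
  rewrite -prodr_const big_mkcond; apply: eq_bigr => v _; case: ifP => _.
    rewrite (bigD1 c)//= eqxx mulr1 big1 ?addr0// => i /negbTE ->.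
    by rewrite mulr0.
  by rewrite -mulr_suml wt1 mul1r.
rewrite bigA_distr_bigA; apply: eq_bigr => l _; rewrite big_split /=; congr (_ * _).
rewrite -big_mkcond /=.
have [/forall_inP h|] := boolP (monochromatic c l e).
  by rewrite big1 // => v ve; rewrite h.
rewrite negb_forall => /existsP[v]; rewrite negb_imply => /andP[ve vc].
by rewrite (bigD1 v)//= (negbTE vc) mul0r.
Qed.

(** The right-hand side is the expected number of edits if the labels are independent
    with distribution [wt]. *)
Lemma dist_le_weights (wt : 'I_3 -> R) : (forall i, 0 <= wt i) -> \sum_i wt i = 1 ->
  (dist (Forb K33) G)%:R <=
  wt ord0 ^+ 2 * #|edges G|%:R +
  (wt 1 ^+ 2 + wt ord_max ^+ 2) * ('C(#|T|, 2)%:R - #|edges G|%:R).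
Proof.
move=> wt0 wt1.
pose W (l : {ffun T -> 'I_3}) := \prod_v wt (l v).
have W1 : \sum_l W l = 1.
  by rewrite /W -(bigA_distr_bigA (fun (v : T) i => wt i)) big1.
have dl l : (dist (Forb K33) G)%:R <= (edit (homogenise l) G)%:R :> R.
  rewrite ler_nat; apply: (dist_attained G _).2 => //; last exact: homogenise_free.
  by exists (homogenise l); exact: homogenise_free.
have -> : (dist (Forb K33) G)%:R = \sum_l W l * (dist (Forb K33) G)%:R.
  by rewrite -mulr_suml W1 mul1r.
apply: le_trans (_ : \sum_l W l * (\sum_(e : {set T} | #|e| == 2)
   (if e \in edges G then (monochromatic ord0 l e : nat) else monochromatic 1%R l e +
     monochromatic ord_max l e)%N)%:R <= _).
  apply: ler_sum => l _; rewrite ler_wpM2l//; first by apply: prodr_ge0.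
  by apply: le_trans (dl l) _; rewrite ler_nat edit_homogenise.
under eq_bigr => l _ do rewrite natr_sum mulr_sumr.
rewrite exchange_big /=.
rewrite (eq_bigr (fun e : {set T} =>
  if e \in edges G then wt ord0 ^+ 2 else wt 1 ^+ 2 + wt ord_max ^+ 2)); last first.
  move=> e /eqP e2; case: ifP => _; first by rewrite expect_monochromatic// e2.
  under eq_bigr => l _ do rewrite natrD mulrDr.
  by rewrite big_split /= !expect_monochromatic// e2.
have sub : edges G \subset [set e : {set T} | #|e| == 2]%SET.
  by apply/fintype.subsetP => e; rewrite inE; case: (G) => E /= /forall_inP h /h.
rewrite (bigID (mem (edges G))) /=; apply: lerD.
  rewrite (eq_bigr (fun=> wt ord0 ^+ 2)) => [|e /andP[_ ->]//].
  rewrite (eq_bigl (mem (edges G))) => [|e]; first by rewrite sumr_const mulr_natr.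
  by rewrite andb_idl// => /(fintype.subsetP sub); rewrite inE.
rewrite (eq_bigr (fun=> wt 1 ^+ 2 + wt ord_max ^+ 2)) => [|e /andP[_ /negbTE->]//].
rewrite (eq_bigl (mem ([set e : {set T} | #|e| == 2] :\: edges G)%SET)) => [|e].
  rewrite sumr_const cardsD (finset.setIidPr sub) card_draws -[leLHS]mulr_natr natrB//.
  by rewrite -card_draws subset_leq_card.
by rewrite !inE andbC.
Qed.

End UpperBound.
(** * The edit distance from Forb(K33) *)

Lemma no_K33_pattern (V : finType) (w b : rel V) :
  symmetric w -> symmetric b ->
  (forall phi : {ffun 'I_3 + 'I_3 -> V}, injective phi -> ~~ blowup_pattern K33 w b phi) ->
  forall x y : seq V, ~~ K33_pattern w b x y.
Proof.
move=> ws bs none x y; apply/negP => /and5P[/eqP sx /eqP sy uxy wxy /andP[bx byy]].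
have v0 : V by case: (x) sx.
pose phi : {ffun 'I_3 + 'I_3 ->
  V} := [ffun z : 'I_3 + 'I_3 => match z with inl i => nth v0 x i | inr j =>
  nth v0 y j end].
have nx (i : 'I_3) : nth v0 x i \in x by rewrite mem_nth// sx.
have ny (i : 'I_3) : nth v0 y i \in y by rewrite mem_nth// sy.
move: uxy; rewrite cat_uniq => /and3P[ux /hasPn dxy uy].
have phi_inj : injective phi.
  move=> [i|i] [j|j]; rewrite !ffunE.
  - by move/eqP; rewrite nth_uniq ?sx// => /eqP/val_inj ->.
  - by move=> e; have := dxy _ (ny j); rewrite -e /= nx.
  - by move=> e; have := dxy _ (ny i); rewrite e /= nx.
  - by move/eqP; rewrite nth_uniq ?sy// => /eqP/val_inj ->.
have pw (z : seq V) (i j : 'I_3) : size z = 3 -> pairwise (fun u v => ~~ b u v) z ->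
    i != j -> ~~ b (nth v0 z i) (nth v0 z j).
  move=> sz /(pairwiseP v0) h ij.
  have [lt|lt|/val_inj e] := ltngtP i j; last by rewrite e eqxx in ij.
    by apply: h => //; rewrite inE sz.
  by rewrite bs; apply: h => //; rewrite inE sz.
move/negP: (none phi phi_inj); apply.
apply/forallP => s; apply/forallP => t; apply/implyP; case: s t => [i|i] [j|j] st;
  rewrite !ffunE.
- by rewrite (K33_same_side i j).1; apply: pw => //; apply: contraNneq st => ->.
- by rewrite K33_across; exact: (allrelP wxy).
- by rewrite adjC K33_across ws; exact: (allrelP wxy).
- by rewrite (K33_same_side i j).2; apply: pw => //; apply: contraNneq st => ->.
Qed.

Lemma K33_three_colour_cost (R : realType) (p : R) : 0 < p -> p ^+ 2 + 2 * p = 1 ->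
  forall eps : R, 0 < eps -> exists2 m : nat, (0 < m)%N &
  forall w b : rel 'I_m, symmetric w -> symmetric b ->
  (forall i j, w i j -> ~~ b i j) ->
  (forall phi : {ffun 'I_3 + 'I_3 -> 'I_m}, injective phi ->
    ~~ blowup_pattern K33 w b phi) ->
  (p ^+ 2 - eps) * m%:R ^+ 2 <=
    p * npairs R (white w) predT + (1 - p) * npairs R (black b) predT.
Proof.
move=> p0 pE eps eps0.
(* 26 is the error constant of [three_colour_cost_ge]. *)
pose theta : R := Num.min 1 (eps / 26).
have th0 : 0 < theta by rewrite lt_min ltr01 divr_gt0.
have th1 : theta <= 1 by rewrite ge_min lexx.
have th2 : 26 * theta <= eps.
  have : theta <= eps / 26 by rewrite ge_min lexx orbT.
  lra.
pose k : R := ((2 * theta ^+ 3) ^+ 2 / 4) ^+ 3.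
have k0 : 0 < k by rewrite exprn_gt0// divr_gt0// exprn_gt0// mulr_gt0// exprn_gt0.
pose s := Num.Def.archi_bound (5 / k).
have hs : 5 <= k * s%:R.
  rewrite mulrC -ler_pdivrMr// ltW// archi_boundP// divr_ge0 ?ltW//.
pose x1 : R := 3 * s%:R ^+ 7 / (2 * theta ^+ 2) ^+ 8.
pose x2 : R := 4 / (2 * theta ^+ 3) ^+ 2.
pose x3 : R := 1 / theta.
have a1 : 0 < (2 * theta ^+ 2) ^+ 8 by rewrite exprn_gt0// mulr_gt0// exprn_gt0.
have a2 : 0 < (2 * theta ^+ 3) ^+ 2 by rewrite exprn_gt0// mulr_gt0// exprn_gt0.
have y1 : 0 <= x1 by rewrite divr_ge0 ?(ltW a1)// mulr_ge0// exprn_ge0.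
have y2 : 0 < x2 by rewrite divr_gt0.
have y3 : 0 < x3 by rewrite divr_gt0.
pose m := Num.Def.archi_bound (x1 + x2 + x3).
have hm : x1 + x2 + x3 < m%:R by apply: archi_boundP; lra.
exists m; first by rewrite -(ltr0n R); lra.
move=> w b ws bs wb none.
have free := no_K33_pattern ws bs none.
have := @three_colour_cost_ge R 'I_m w b ws bs wb free p theta s p0 pE th0 th1.
rewrite card_ord => /(_ hs).
have h1 : 3 * s%:R ^+ 7 <= (2 * theta ^+ 2) ^+ 8 * m%:R.
  by rewrite [leRHS]mulrC -ler_pdivrMr// -/x1; lra.
have h2 : 4 <= (2 * theta ^+ 3) ^+ 2 * m%:R.
  by rewrite [leRHS]mulrC -ler_pdivrMr// -/x2; lra.
have h3 : 1 <= theta * m%:R.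
  by rewrite [leRHS]mulrC -ler_pdivrMr// -/x3; lra.
move=> /(_ h1 h2 h3); apply: le_trans.
by have := ler_wpM2r (sqr_ge0 (m%:R : R)) th2; lra.
Qed.
Section EditDistanceOfForbK33.
Local Open Scope classical_set_scope.
Local Open Scope ring_scope.
Context (R : realType).

Let pstar : R := Num.sqrt 2 - 1.

Lemma pstar_facts : [/\ 0 < pstar, pstar < 1, pstar ^+ 2 + 2 * pstar = 1 & pstar ^+ 2 =
  3 - 2 * Num.sqrt 2].
Proof.
have s2 : Num.sqrt 2 ^+ 2 = 2 :> R by rewrite sqr_sqrtr.
have s0 : 0 <= Num.sqrt 2 :> R by exact: sqrtr_ge0.
rewrite /pstar; set s : R := Num.sqrt 2 in s2 s0 *.
have h : ((s - 1) ^+ 2 = 3 - 2 * s) by rewrite sqrrB s2 expr1n; ring.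
split => //; [nra|nra|].
by rewrite h; ring.
Qed.

(** The reciprocal of 1/p + 2/(1-p), extended to the endpoints; its value is that of
    g_K' by [crg_g_Kprime]. *)
Definition Kprime_val (p : R) : R := p * (1 - p) / (1 + p).

Lemma Kprime_valE (p : R) : 0 <= p -> Kprime_val p = 3 - (1 + p) - 2 / (1 + p).
Proof. by move=> p0; rewrite /Kprime_val; field; rewrite gt_eqF//; lra. Qed.

Lemma Kprime_val_sub (p q : R) : 0 <= p -> 0 <= q ->
  Kprime_val q - Kprime_val p = (q - p) * (2 - (1 + p) * (1 + q)) / ((1 + p) * (1 + q)).
Proof.
by move=> p0 q0; rewrite !Kprime_valE//; field; rewrite !gt_eqF//; lra.
Qed.

Lemma Kprime_val_pstar : Kprime_val pstar = pstar ^+ 2.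
Proof.
have [p0 p1 pE _] := pstar_facts.
have h : 1 + pstar != 0 by rewrite gt_eqF//; lra.
rewrite /Kprime_val; apply: (mulIf h); rewrite divfK//.
have -> : pstar ^+ 2 * (1 + pstar) = pstar * (pstar + pstar ^+ 2) by ring.
by have -> : pstar + pstar ^+ 2 = 1 - pstar by lra.
Qed.

Lemma Kprime_val_lt (p : R) : 0 <= p -> p != pstar -> Kprime_val p < pstar ^+ 2.
Proof.
move=> p0 pn; have [s0 s1 sE _] := pstar_facts.
rewrite -Kprime_val_pstar -subr_gt0 Kprime_val_sub ?(ltW s0)//.
have h1 : 0 < 1 + p by lra.
have h2 : 0 < 1 + pstar by lra.
apply: divr_gt0; last by rewrite mulr_gt0.
have -> : (pstar - p) * (2 - (1 + p) * (1 + pstar)) =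
  (1 + pstar) * (pstar - p) ^+ 2 + (pstar - p) * (1 - 2 * pstar - pstar ^+ 2) by ring.
have -> : 1 - 2 * pstar - pstar ^+ 2 = 0 by lra.
by rewrite mulr0 addr0 mulr_gt0// lt_def sqr_ge0 sqrf_eq0 subr_eq0 eq_sym pn.
Qed.

(** For a diagonal form the optimal weights are inverse to the diagonal entries. *)
Lemma crg_g_Kprime (p : R) : 0 <= p <= 1 -> crg_g Kprime p = Kprime_val p.
Proof.
move=> /andP[p0 p1]; have [[u su ->] umin] := @crg_g_attained R 3 Kprime p isT.
have quadE (v : 'cV[R]_3) : quad (crg_mx Kprime p) v =
    p * v ord0 ord0 ^+ 2 + (1 - p) * v 1 ord0 ^+ 2 + (1 - p) * v ord_max ord0 ^+ 2.
  have i1 : lift ord0 ord0 = 1 :> 'I_3 by apply/val_inj.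
  have i2 : lift ord0 (lift ord0 ord0) = ord_max :> 'I_3 by apply/val_inj.
  rewrite /quad !mxE !big_ord_recl big_ord0 !mxE !big_ord_recl !big_ord0 !mxE /=.
  rewrite i2 i1 /=; ring.
have d0 : 0 < 1 + p by lra.
have sumE (v : 'cV[R]_3) : \sum_i v i ord0 = v ord0 ord0 + v 1 ord0 + v ord_max ord0 :> R.
  rewrite !big_ord_recl big_ord0 addr0 -addrA; congr (_ + (_ + _));
    congr (v _ _); exact/val_inj.
have [_ attained] := @crg_g_attained R 3 Kprime p isT.
rewrite quadE; have [u0] := su; rewrite sumE => u1.
have := u0 ord0; have := u0 1; have := u0 ord_max.
move: u1; set a := u ord0 ord0; set b := u 1 ord0; set c := u ord_max ord0 => u1 c0 b0 a0.
apply/eqP; rewrite eq_le; apply/andP; split.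
  pose x : 'cV[R]_3 := \col_i (if i == ord0 then (1 - p) / (1 + p) else p / (1 + p)).
  have sx : simplex x.
    split=> [i|]; last by rewrite sumE !mxE /=; field; rewrite gt_eqF.
    by rewrite mxE; case: ifP => _; rewrite divr_ge0//; lra.
  have := umin x sx; rewrite !quadE !mxE /= -/a -/b -/c => /le_trans; apply.
  by rewrite /Kprime_val le_eqVlt; apply/orP; left; apply/eqP; field; rewrite gt_eqF.
rewrite /Kprime_val ler_pdivrMr//.
have -> : a = 1 - b - c by lra.
have h1 : 0 <= (1 + p) * (1 - p) * (b - c) ^+ 2.
  by rewrite mulr_ge0 ?sqr_ge0// mulr_ge0//; lra.
have h2 : 0 <= ((1 + p) * (b + c) - 2 * p) ^+ 2 by exact: sqr_ge0.
lra.
Qed.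

Lemma local_max_Kprime (p : R) : local_max01 (crg_g Kprime) p <-> p = pstar.
Proof.
have [s0 s1 sE _] := pstar_facts.
split=> [[/andP[p0 p1] /nbhs_ballP[e /= e0 he]]|->]; last first.
  split; first by apply/andP; split; lra.
  apply/nbhs_ballP; exists 1 => //= q _ q01; rewrite !crg_g_Kprime//;
    last by apply/andP; split; lra.
  case/andP: q01 => q0 _; rewrite Kprime_val_pstar.
  by have [->|/(Kprime_val_lt q0)/ltW] := eqVneq q pstar; rewrite ?Kprime_val_pstar.
have step q : 0 <= q -> q <= 1 -> `|q - p| < e -> Kprime_val q <= Kprime_val p.
  move=> q0 q1 qp; have q01 : 0 <= q <= 1 by rewrite q0 q1.
  have p01 : 0 <= p <= 1 by rewrite p0 p1.
  rewrite -!crg_g_Kprime//; apply: he => //.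
  by rewrite /ball /= distrC.
have mono_step q : 0 <= q -> q <= 1 -> `|q - p| < e ->
    (q - p) * (2 - (1 + p) * (1 + q)) <= 0.
  move=> q0 q1 qp; have := step q q0 q1 qp; rewrite -subr_le0 Kprime_val_sub//.
  have d0 : 0 < (1 + p) * (1 + q) by rewrite mulr_gt0//; lra.
  by rewrite pmulr_lle0// invr_gt0.
apply/eqP; rewrite eq_le; apply/andP; split; rewrite leNgt; apply/negP => lt.
  pose t := Num.min (e / 2) ((p - pstar) / 2).
  have t0 : 0 < t by rewrite lt_min; apply/andP; split; lra.
  have t1 : t <= e / 2 by rewrite ge_min lexx.
  have t2 : t <= (p - pstar) / 2 by rewrite ge_min lexx orbT.
  have := mono_step (p - t) ltac:(lra) ltac:(lra).
  have -> : p - t - p = - t by ring.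
  rewrite normrN gtr0_norm// => /(_ ltac:(lra)).
  have h : 0 < (1 + p) * (1 + (p - t)) - 2.
    have : (1 + pstar) * (1 + pstar) < (1 + p) * (1 + (p - t)) by apply: ltr_pM; lra.
    lra.
  have := mulr_gt0 t0 h; lra.
pose t := Num.min (e / 2) ((pstar - p) / 2).
have t0 : 0 < t by rewrite lt_min; apply/andP; split; lra.
have t1 : t <= e / 2 by rewrite ge_min lexx.
have t2 : t <= (pstar - p) / 2 by rewrite ge_min lexx orbT.
have := mono_step (p + t) ltac:(lra) ltac:(lra).
have -> : p + t - p = t by ring.
rewrite gtr0_norm// => /(_ ltac:(lra)).
have h : 0 < 2 - (1 + p) * (1 + (p + t)).
  have : (1 + p) * (1 + (p + t)) < (1 + pstar) * (1 + pstar) by apply: ltr_pM; lra.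
  lra.
have := mulr_gt0 t0 h; lra.
Qed.

Lemma bin2_real (n : nat) : 2 * 'C(n, 2)%:R = n%:R * (n%:R - 1) :> R.
Proof.
case: n => [|n]; first by rewrite bin0n mulr0 mul0r.
have := bin_ffact n.+1 2; rewrite ffactnS ffactn1 /= => /(congr1 (fun k => k%:R : R)).
by rewrite !natrM -natr1 mulrC => ->; rewrite -natr1; ring.
Qed.

Lemma dist_le_density (n : nat) (G : sgraph 'I_n) (p : R) : 0 <= p -> p <= 1 ->
  (dist (Forb K33) G)%:R <= ((1 - p) / (1 + p)) ^+ 2 * #|edges G|%:R +
    2 * (p / (1 + p)) ^+ 2 * ('C(n, 2)%:R - #|edges G|%:R).
Proof.
move=> p0 p1.
pose wt (i : 'I_3) : R := if i == ord0 then (1 - p) / (1 + p) else p / (1 + p).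
have := @dist_le_weights R 'I_n G wt.
rewrite card_ord /wt /= mulr_natl mulr2n; apply.
  by move=> i; case: ifP => _; rewrite divr_ge0//; lra.
by rewrite !big_ord_recl big_ord0 /=; field; rewrite gt_eqF//; lra.
Qed.

(** At density [pstar] both coefficients in [dist_le_density] equal [pstar ^+ 2], so
    the number of edges drops out. *)
Lemma dist_max_le (n : nat) : (dist_max (Forb K33) n)%:R <= pstar ^+ 2 * 'C(n, 2)%:R.
Proof.
have [s0 s1 sE _] := pstar_facts.
rewrite /dist_max.
have [|G ->] := @bigop.eq_bigmax _ (fun G : sgraph 'I_n => dist (Forb K33) G).
  apply/card_gt0P; have h : [forall e in (finset.set0 : {set {set 'I_n}}), #|e| == 2].
    by apply/forall_inP => e; rewrite inE.
  by exists (SGraph h).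
apply: le_trans (dist_le_density G (ltW s0) (ltW s1)) _.
have d0 : 1 + pstar != 0 by rewrite gt_eqF//; lra.
have -> : (1 - pstar) / (1 + pstar) = pstar.
  by apply: (mulIf d0); rewrite divfK//; lra.
have -> : 2 * (pstar / (1 + pstar)) ^+ 2 = pstar ^+ 2.
  have d2 : (1 + pstar) ^+ 2 = 2 by lra.
  by rewrite expr_div_n d2; field.
lra.
Qed.

Lemma dist_ge_quasirandom (eps : R) : 0 < eps -> exists2 delta : R, 0 < delta &
  exists n0 : nat, forall n (G : sgraph 'I_n), (n0 <= n)%N ->
    cut_close delta (adj_fun R G) (fun=> pstar) ->
    (pstar ^+ 2 - eps) * n%:R ^+ 2 <= 2 * (dist (Forb K33) G)%:R.
Proof.
move=> eps0; have [s0 s1 sE _] := pstar_facts.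
have [delta d0 [n0 h]] := edit_lower_bound (ltW s0) (ltW s1) (K33_three_colour_cost
  s0 sE) eps0.
exists delta => //; exists n0 => n G nn cc.
have [|[F FF ->] _] := @dist_attained (Forb K33) 'I_n G.
  by exists (homogenise G [ffun=> ord0]); exact: homogenise_free.
by have := h _ F G _ cc FF; rewrite card_ord; apply.
Qed.

Lemma inv_small (c e : R) : 0 <= c -> 0 < e ->
  exists N : nat, forall n : nat, (N <= n)%N -> (0 < n)%N /\ c / n%:R <= e.
Proof.
move=> c0 e0; exists (Num.Def.archi_bound (c / e)).+1 => n Nn.
have n0 : (0 < n)%N by apply: leq_trans Nn.
split=> //; rewrite ler_pdivrMr ?ltr0n// mulrC -ler_pdivrMr//.
apply: le_trans (ltW (archi_boundP _)) _; first by rewrite divr_ge0// ltW.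
by rewrite ler_nat; exact: leq_trans (leqnSn _) Nn.
Qed.

(** Whatever holds for all large quasirandom graphs holds with high probability. *)
Lemma quasirandom_whp (p : R) (A : forall n, pred (sgraph 'I_n)) (delta : R) (n0 : nat) :
  0 <= p -> p <= 1 -> 0 < delta ->
  (forall n (G : sgraph 'I_n), (n0 <= n)%N ->
     cut_close delta (adj_fun R G) (fun=> p) -> A n G) ->
  gnp_prob p (A n) @[n --> \oo] --> (1 : R).
Proof.
move=> p0 p1 d0 hA; apply/cvgrPdist_le => e e0.
have d4 : 0 < delta ^+ 4 by rewrite exprn_gt0.
have [N hN] := @inv_small (6 / delta ^+ 4) e (ltW (divr_gt0 (ltr0Sn _ _) d4)) e0.
exists (maxn n0 N) => // n /=; rewrite geq_max => /andP[n0n /hN[n_gt0 small]].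
rewrite ger0_norm ?subr_ge0 ?gnp_prob_le1//.
have := quasirandom_prob p0 p1 n_gt0 d0.
have : gnp_prob p (fun G :
  sgraph 'I_n => c4_dev p G <= delta ^+ 4 * n%:R ^+ 4) <= gnp_prob p (A n).
  apply: gnp_prob_sub => // G h; apply: hA => //.
  by apply: c4_dev_cut_close h => //; exact: ltW.
have -> : 6 / (delta ^+ 4 * n%:R) = 6 / delta ^+ 4 / n%:R.
  by field; rewrite !gt_eqF// ltr0n.
lra.
Qed.

Lemma is_pstar_sqrt2 : is_pstar (Forb K33) pstar.
Proof.
have [s0 s1 sE _] := pstar_facts.
split; first by apply/andP; split; lra.
move=> eps eps0; have [delta d0 [n0 h]] := dist_ge_quasirandom eps0.
apply: (quasirandom_whp (ltW s0) (ltW s1) d0) => n G nn cc.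
have le := h n G nn cc; have ub := dist_max_le n.
have dm : (dist (Forb K33) G)%:R <= (dist_max (Forb K33) n)%:R :> R.
  by rewrite ler_nat; exact: bigop.leq_bigmax.
rewrite ger0_norm ?subr_ge0//.
have := bin2_real n => b2.
have n1 : 0 <= pstar ^+ 2 * n%:R by rewrite mulr_ge0 ?sqr_ge0.
have n2 : 0 <= eps * n%:R ^+ 2 by rewrite mulr_ge0 ?sqr_ge0 ?ltW.
have : 2 * (pstar ^+ 2 * 'C(n, 2)%:R) =
  pstar ^+ 2 * n%:R ^+ 2 - pstar ^+ 2 * n%:R by rewrite mulrCA b2; ring.
lra.
Qed.

Lemma dist_max_ge (eps : R) : 0 < eps -> exists n0 : nat, forall n, (n0 <= n)%N ->
  (pstar ^+ 2 - eps) * n%:R ^+ 2 <= 2 * (dist_max (Forb K33) n)%:R.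
Proof.
move=> eps0; have [s0 s1 sE _] := pstar_facts.
have [delta d0 [n0 h]] := dist_ge_quasirandom eps0.
have d4 : 0 < delta ^+ 4 by rewrite exprn_gt0.
have [N hN] := @inv_small (6 / delta ^+ 4) 2^-1 (ltW (divr_gt0 (ltr0Sn _ _) d4)) ltac:(by
  rewrite invr_gt0).
exists (maxn n0 N) => n; rewrite geq_max => /andP[n0n /hN[n_gt0 small]].
have := quasirandom_prob (ltW s0) (ltW s1) n_gt0 d0.
have -> : 6 / (delta ^+ 4 * n%:R) = 6 / delta ^+ 4 / n%:R.
  by field; rewrite !gt_eqF// ltr0n.
move=> pr; have [/existsP[G hG]|none] := boolP [exists G : sgraph 'I_n, c4_dev pstar G <=
  delta ^+ 4 * n%:R ^+ 4].
  apply: le_trans (h n G n0n _) _; first by apply: c4_dev_cut_close hG; exact: ltW.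
  by rewrite ler_wpM2l// ler_nat; exact: bigop.leq_bigmax.
move: pr; rewrite /gnp_prob big1; first lra.
move=> G hG; exfalso; move/negP: none; apply; apply/existsP; by exists G.
Qed.

Lemma has_dstar_sqrt2 : has_dstar (Forb K33) (pstar ^+ 2).
Proof.
have [s0 s1 sE _] := pstar_facts.
apply/cvgrPdist_le => e e0.
have [n0 h] := dist_max_ge e0.
exists (maxn n0 2) => // n /=; rewrite geq_max => /andP[/h lo n2].
have ub := dist_max_le n; have b2 := bin2_real n.
have C0 : 0 < 'C(n, 2)%:R :> R by rewrite ltr0n bin_gt0.
have le1 : (dist_max (Forb K33) n)%:R / 'C(n, 2)%:R <= pstar ^+ 2 by rewrite ler_pdivrMr.
rewrite ger0_norm ?subr_ge0// lerBlDr -lerBlDl ler_pdivlMr//.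
have [neg|pos] := leP (pstar ^+ 2 - e) 0.
  by apply: le_trans (_ : 0 <= _) => //; rewrite mulr_le0_ge0// ltW.
have : (pstar ^+ 2 - e) * (2 * 'C(n, 2)%:R) <= (pstar ^+ 2 - e) * n%:R ^+ 2.
  rewrite ler_wpM2l ?(ltW pos)// b2; have := ler0n R n; lra.
lra.
Qed.

Lemma edges_of_cut_close (n : nat) (G : sgraph 'I_n) (p delta : R) :
  cut_close delta (adj_fun R G) (fun=> p) ->
  `|2 * #|edges G|%:R - p * n%:R ^+ 2| <= delta * n%:R ^+ 2.
Proof.
move=> /(_ predT predT); rewrite card_ord /= sumrB.
have E2 e : e \in edges G -> #|e| = 2 by move/edge_card/eqP.
have -> : \sum_(x : 'I_n * 'I_n) adj_fun R G x = 2 * #|edges G|%:R.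
  have := sum_pairs_of_edges E2 => /(congr1 (fun k => k%:R : R)).
  by rewrite natrM natr_sum.
by rewrite sumr_const card_prod card_ord -[p *+ _]mulr_natr natrM expr2.
Qed.

(** For a quasirandom graph of density [p] the averaged labelling leaves a gap of order
    [(pstar ^+ 2 - Kprime_val p) * n ^+ 2] to the maximal distance, so the event in the
    definition has probability tending to 0 rather than 1. *)
Lemma is_pstar_unique (p : R) : is_pstar (Forb K33) p -> p = pstar.
Proof.
move=> [/andP[p0 p1] hp]; have [s0 s1 sE _] := pstar_facts.
apply/eqP; apply: contraT => pn.
have gl := Kprime_val_lt p0 pn; set gam := pstar ^+ 2 - Kprime_val p.
have gam0 : 0 < gam by rewrite subr_gt0.
(* Lower bound and upper bound each lose at most [gam / 4] in the density, that is
   [gam / 8 * n ^+ 2] edits, out of a gap of [gam / 2 * n ^+ 2]. *)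
pose eps := gam / 8.
have eps0 : 0 < eps by rewrite divr_gt0.
have gam4 : 0 < gam / 4 by rewrite divr_gt0.
have [n0 h] := dist_max_ge gam4.
pose A n (G : sgraph 'I_n) := `|(dist_max (Forb K33) n)%:R - (dist (Forb K33) G)%:R| <=
  eps * n%:R ^+ 2 :> R.
have to1 := hp eps eps0; rewrite -/(A _) in to1.
have toC : gnp_prob p (predC (A n)) @[n --> \oo] --> (1 : R).
  apply: (quasirandom_whp (delta := gam / 4) (n0 := maxn n0 1) p0 p1 gam4) => n G.
  rewrite geq_max => /andP[/h lo n_gt0] /edges_of_cut_close.
  rewrite ler_norml => /andP[el eu].
  have ub := dist_le_density G p0 p1; have b2 := bin2_real n.
  rewrite /= /A -ltNge; apply: lt_le_trans (ler_norm _).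
  set a := ((1 - p) / (1 + p)) ^+ 2 in ub; set b := 2 * (p / (1 + p)) ^+ 2 in ub.
  have d0 : 0 < 1 + p by lra.
  have gE : Kprime_val p = a * p + b * (1 - p).
    by rewrite /Kprime_val /a /b; field; rewrite gt_eqF.
  have a0 : 0 <= a by exact: sqr_ge0.
  have b0 : 0 <= b by rewrite mulr_ge0// sqr_ge0.
  have ab : a + b <= 1.
    have -> : a + b = ((1 - p) ^+ 2 + 2 * p ^+ 2) / (1 + p) ^+ 2 by rewrite /a /b; field;
      rewrite gt_eqF.
    rewrite ler_pdivrMr ?exprn_gt0// mul1r; nra.
  have nR : 0 < n%:R :> R by rewrite ltr0n.
  have n2 : 0 < n%:R ^+ 2 :> R by rewrite exprn_gt0.
  set N := n%:R ^+ 2 in n2 el eu lo *; set e : R := #|edges G|%:R in el eu ub.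
  set C : R := 'C(n, 2)%:R in ub b2.
  have CN : 2 * C <= N by rewrite b2 /N; lra.
  have g0 : 0 < gam * N by rewrite mulr_gt0.
  have u1 : a * (2 * e) <= a * (p * N + gam / 4 * N) by rewrite ler_wpM2l//; lra.
  have u2 : b * (2 * (C - e)) <=
    b * ((1 - p) * N + gam / 4 * N) by rewrite ler_wpM2l//; lra.
  have u3 : (a + b) * (gam / 4 * N) <= gam / 4 * N.
    by rewrite ler_piMl// mulr_ge0 ?(ltW gam4)// ltW.
  have u4 : Kprime_val p * N = a * p * N + b * (1 - p) * N by rewrite gE; ring.
  have u5 : pstar ^+ 2 * N = gam * N + Kprime_val p * N by rewrite /gam; ring.
  rewrite /eps; lra.
have to0 : gnp_prob p (A n) @[n --> \oo] --> (1 - 1 : R).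
  have -> : (fun n => gnp_prob p (A n)) = (fun n => 1 - gnp_prob p (predC (A n))).
    by apply/funext => n; rewrite -(gnp_probC p (A n)); ring.
  by apply: cvgB => //; exact: cvg_cst.
have e10 : (1 : R) = 1 - 1 by apply: cvg_unique to1 to0; exact: norm_hausdorff.
by move: (oner_neq0 R); rewrite {1}e10 subrr eqxx.
Qed.

End EditDistanceOfForbK33.

Theorem theorem13 (R : realType) :
  [/\ forall p : R, is_pstar (Forb K33) p <-> p = Num.sqrt 2 - 1,
      has_dstar (Forb K33) (3 - 2 * Num.sqrt 2 : R)
    & forall p : R, local_max01 (crg_g Kprime) p <-> is_pstar (Forb K33) p].
Proof.
have pstarP (p : R) : is_pstar (Forb K33) p <-> p = Num.sqrt 2 - 1.
  by split=> [/is_pstar_unique //|->]; exact: is_pstar_sqrt2.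
have [_ _ _ pstarE] := pstar_facts R.
split=> //; first by rewrite -pstarE; exact: has_dstar_sqrt2.
by move=> p; apply: (iff_trans (local_max_Kprime p)); apply: iff_sym.
Qed.
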